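(* Let $f,g:[0;1]\to[0;1]^2$ be computable with $f(0)=(0,0)$, $f(1)=(1,1)$, $g(0)=(0,1)$, $g(1)=(1,0)$ and $f(t),g(t)\in(0;1)^2$ for $0<t<1$. If the predicate $Q$ does not hold, then there is a computable point $x\in\mathrm{range}(f)\cap\mathrm{range}(g)$.
   Context: $B(z,r)$ denotes the open Euclidean ball in $\mathbb{R}^2$, $\overline{B(z,r)}$ its closure. For rationals $a,r$ with $\overline{B(f(a),r)}\subseteq(0;1)^2$: $(p_{ar};q_{ar})$ is the longest open interval $I$ with $a\in I$ and $f(I)\subseteq B(f(a),r)$; $(p'_{ar};q'_{ar})$ is the longest open interval $I$ with $a\in I$ and $f(\overline I)\subseteq\overline{B(f(a),r)}$; $K_{ar}:=[p'_{ar};p_{ar}]$, $L_{ar}:=[q_{ar};q'_{ar}]$. The predicate $Q$ states: there are rationals $a,r,s$ with $0<r<s$ and $\overline{B(f(a),s)}\subseteq(0;1)^2$ such that for every rational $t\in[r;s]$, $f(\max K_{at})\in\mathrm{range}(g)$ or $f(\min L_{at})\in\mathrm{range}(g)$. A point of $\mathbb{R}^2$ is computable if both coordinates are computable reals. *)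

(* Defs.v *)
From HB Require Import structures.
From mathcomp Require Import all_boot all_order all_algebra.
From mathcomp Require Import all_classical all_reals all_analysis.
From Stdlib Require Cantor.

Set Implicit Arguments.
Unset Strict Implicit.
Unset Printing Implicit Defensive.

Import Order.TTheory GRing.Theory Num.Theory.
Import numFieldNormedType.Exports.

(* Partial recursive functions relative to an oracle in Baire space, the
   standard model of Type-2 computability.  Programs are unary: several
   arguments are passed through the Cantor pairing. *)
Inductive code : Type :=
| Zero | Succ | Fst | Snd | Oracle
| Pair of code & code
| Comp of code & code
| Prec of code & code
| Mu of code.

Definition npair (m n : nat) : nat := Cantor.to_nat (m, n).
Definition nfst (n : nat) : nat := fst (Cantor.of_nat n).
Definition nsnd (n : nat) : nat := snd (Cantor.of_nat n).

(* [eval phi c n y]: with oracle [phi], program [c] halts on [n] with output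
   [y]. *)
Inductive eval (phi : nat -> nat) : code -> nat -> nat -> Prop :=
| eval_Zero n : eval phi Zero n 0
| eval_Succ n : eval phi Succ n n.+1
| eval_Fst n : eval phi Fst n (nfst n)
| eval_Snd n : eval phi Snd n (nsnd n)
| eval_Oracle n : eval phi Oracle n (phi n)
| eval_Pair c d n x y :
    eval phi c n x -> eval phi d n y -> eval phi (Pair c d) n (npair x y)
| eval_Comp c d n x y :
    eval phi d n x -> eval phi c x y -> eval phi (Comp c d) n y
| eval_Prec0 c d a y :
    eval phi c a y -> eval phi (Prec c d) (npair a 0) y
| eval_PrecS c d a m x y :
    eval phi (Prec c d) (npair a m) x ->
    eval phi d (npair a (npair m x)) y ->
    eval phi (Prec c d) (npair a m.+1) y
(* the values [(w k).+1] say that [c] halts with a nonzero output below [m] *)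
| eval_Mu c a m (w : nat -> nat) :
    eval phi c (npair a m) 0 ->
    (forall k, k < m -> eval phi c (npair a k) (w k).+1) ->
    eval phi (Mu c) a m.

Definition realizes (c : code) (phi psi : nat -> nat) : Prop :=
  forall n, eval phi c n (psi n).

(* The trivial oracle makes [eval] ordinary recursiveness. *)
Definition recursive (psi : nat -> nat) : Prop :=
  exists c : code, realizes c (fun=> 0) psi.

Local Open Scope classical_set_scope.
Local Open Scope ring_scope.

(* Standard numbering of the rationals: <<i,j>,k> codes (i - j) / (k + 1). *)
Definition nuQ (n : nat) : rat :=
  ((nfst (nfst n))%:R - (nsnd (nfst n))%:R) / (nsnd n).+1%:R.

(* Cauchy representation: [phi] lists rationals converging to [x] fast. *)
Definition name_of (R : realType) (phi : nat -> nat) (x : R) : Prop :=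
  forall n : nat, `|x - ratr (nuQ (phi n))| <= 2 ^- n.

Definition computable_real (R : realType) (x : R) : Prop :=
  exists2 phi : nat -> nat, recursive phi & name_of phi x.

Definition computable_point (R : realType) (z : R * R) : Prop :=
  computable_real z.1 /\ computable_real z.2.

(* A single program sends every name of every x in D to a name of h x. *)
Definition computable_on (R : realType) (D : set R) (h : R -> R) : Prop :=
  exists c : code, forall x, D x -> forall phi, name_of phi x ->
    exists2 psi, realizes c phi psi & name_of psi (h x).

(* A path [0;1] -> R^2 is a total function, only its restriction to [0;1]
   being relevant. *)
Definition computable_path (R : realType) (f : R -> R * R) : Prop :=
  computable_on `[0, 1] (fun t => (f t).1) /\
  computable_on `[0, 1] (fun t => (f t).2).

Definition path_range (R : realType) (f : R -> R * R) : set (R * R) :=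
  f @` `[0, 1].

Definition closed_square (R : realType) : set (R * R) := `[0, 1] `*` `[0, 1].
Definition open_square (R : realType) : set (R * R) := `]0, 1[ `*` `]0, 1[.
Arguments closed_square {R}.
Arguments open_square {R}.

(* Euclidean; the library's [ball] on [R * R] is for the sup norm, which
   induces the same topology, hence the same [closure]. *)
Definition eball (R : realType) (z : R * R) (r : R) : set (R * R) :=
  [set w | Num.sqrt ((w.1 - z.1) ^+ 2 + (w.2 - z.2) ^+ 2) < r].

Section Intervals.
Variables (R : realType) (f : R -> R * R) (a r : R).

(* A pair [I] stands for the open interval ]I.1, I.2[ of [0;1]. *)
Definition open_nbhd_interval (I : R * R) : Prop :=
  [/\ 0 <= I.1, I.2 <= 1 & I.1 < a < I.2].

Definition longest (P : set (R * R)) (I : R * R) : Prop :=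
  P I /\ forall J, P J -> J.2 - J.1 <= I.2 - I.1.

Definition inside (I : R * R) : Prop :=
  open_nbhd_interval I /\ f @` `]I.1, I.2[ `<=` eball (f a) r.

Definition inside' (I : R * R) : Prop :=
  open_nbhd_interval I /\
  f @` closure `]I.1, I.2[ `<=` closure (eball (f a) r).

Definition pq : R * R := xget (0, 0) (longest inside).
Definition pq' : R * R := xget (0, 0) (longest inside').

Definition K : set R := `[pq'.1, pq.1].
Definition L : set R := `[pq.2, pq'.2].

End Intervals.

Definition is_max (R : realType) (A : set R) (x : R) : Prop :=
  A x /\ ubound A x.
Definition is_min (R : realType) (A : set R) (x : R) : Prop :=
  A x /\ lbound A x.

Definition predQ (R : realType) (f g : R -> R * R) : Prop :=
  exists a r s : rat,
    [/\ 0 <= a <= 1, 0 < r < s,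
        closure (eball (f (ratr a)) (ratr s)) `<=` open_square &
        forall t : rat, r <= t <= s ->
          (exists2 x, is_max (K f (ratr a) (ratr t)) x & path_range g (f x)) \/
          (exists2 x, is_min (L f (ratr a) (ratr t)) x & path_range g (f x))].

(* Main.v *)
(** Put F(s,t) = f(s) - g(t), and count modulo 2 how often the path
    t |-> F(s,t) crosses a fixed ray.  This parity is defined whenever f(s) is
    not in range(g); it is computable from f(s) and g, because it can be read
    off any approximation that is fine compared with min_t |F(s,t)|; it is
    locally constant in s, because near t = 0 and t = 1 the vector F stays away
    from the ray; it is odd at s = 0 and even at s = 1.

    If f(a) is in range(g) for some dyadic a, then f(a) is the required
    computable point.  Otherwise the parity is a total recursive function of
    the dyadic points, and bisection, always keeping an odd left end and an
    even right end, converges to a computable real x.  The parity is not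
    locally constant at x, so f(x) is in range(g). *)
From mathcomp Require Import all_boot all_order all_algebra.
From mathcomp Require Import all_classical all_reals all_analysis.
From mathcomp Require Import zify ring lra.
Require Import Defs.
Import Order.TTheory GRing.Theory Num.Theory.
Import numFieldNormedType.Exports.
Local Open Scope classical_set_scope.

(** * Recursive functions *)

(** [computable_on] provides only a program acting on names, and its output may depend on the name
    as well as on the point. The parity, however, needs integer approximations valid on a whole grid
    cell at a level that can be found effectively. This is why oracle queries are tracked and why
    compactness enters as Koenig's lemma.

    The parity itself is a count of label changes along a finite grid, so its invariance is a
    statement modulo 2 about a strip of squares and no winding number has to be defined.

    The case distinction on dyadic points is classical. The resulting real is computable, but the
    argument yields no procedure uniform in f and g. *)

Lemma nfst_pair m n : nfst (npair m n) = m.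
Proof. exact: (congr1 fst (Cantor.cancel_of_to (m, n))). Qed.

Lemma nsnd_pair m n : nsnd (npair m n) = n.
Proof. exact: (congr1 snd (Cantor.cancel_of_to (m, n))). Qed.

Lemma npair_eta n : npair (nfst n) (nsnd n) = n.
Proof. by rewrite /npair /nfst /nsnd; case: (Cantor.of_nat n) (Cantor.cancel_to_of n). Qed.

Lemma npair_inj m n m' n' : npair m n = npair m' n' -> m = m' /\ n = n'.
Proof.
by move=> h; have := congr1 nfst h; have := congr1 nsnd h; rewrite !(nfst_pair, nsnd_pair).
Qed.

(** In the [Prec] case the input appears through an equation, because [npair a 0] and [npair a m.+1]
    are not constructor patterns; [npair_inj] then separates the two rules. *)
Lemma eval_inv phi c n y : eval phi c n y ->
  match c with
  | Zero => y = 0 | Succ => y = n.+1 | Fst => y = nfst n | Snd => y = nsnd n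
  | Oracle => y = phi n
  | Pair c d => exists x x', [/\ eval phi c n x, eval phi d n x' & y = npair x x']
  | Comp c d => exists2 x, eval phi d n x & eval phi c x y
  | Prec c d => exists a, (n = npair a 0 /\ eval phi c a y) \/
      exists m x, [/\ n = npair a m.+1, eval phi (Prec c d) (npair a m) x &
        eval phi d (npair a (npair m x)) y]
  | Mu c => exists2 w : nat -> nat, eval phi c (npair n y) 0 &
      forall k, k < y -> eval phi c (npair n k) (w k).+1
  end.
Proof.
case=> //=.
- by move=> c' d n' x x' h h'; exists x, x'.
- by move=> c' d n' x y' h h'; exists x.
- by move=> c' d a y' h; exists a; left.
- by move=> c' d a m x y' h h'; exists a; right; exists m, x.
- by move=> c' a m w h h'; exists w.
Qed.

Lemma eval_PrecP phi c d a m y : eval phi (Prec c d) (npair a m) y <->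
  exists w : nat -> nat, [/\ eval phi c a (w 0),
    forall k, k < m -> eval phi d (npair a (npair k (w k))) (w k.+1) & w m = y].
Proof.
split=> [|[w [w0 wS <-]]]; last first.
  have : forall k, k <= m -> eval phi (Prec c d) (npair a k) (w k).
    elim=> [_|k ih km]; first exact: eval_Prec0.
    by apply: eval_PrecS (wS _ km); apply: ih; apply: ltnW.
  exact.
elim: m y => [|m ih] y /eval_inv[a' [[e h]|[m' [x [e h1 h2]]]]];
  have [ea em] := npair_inj _ _ _ _ e => //.
  by exists (fun=> y); split => //; rewrite ea.
move: em h1 h2 => [<-]; rewrite -ea => h1 h2.
have [w [w0 wS wm]] := ih _ h1.
  (* Only the value at [m.+1] matters among the new ones; beyond it the sequence is arbitrary. *)
  exists (fun k => if k <= m then w k else y); split => //=; last by rewrite ltnn.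
  move=> k; rewrite ltnS => km; rewrite km.
  case: ltnP => [lt|ge]; first exact: wS.
  by have -> : k = m by [apply/eqP; rewrite eqn_leq km ge]; rewrite wm.
Qed.

Lemma eval_fun phi c n y y' : eval phi c n y -> eval phi c n y' -> y = y'.
Proof.
elim: c n y y' => [||||| c ihc d ihd|c ihc d ihd|c ihc d ihd|c ihc] n y y' h h'.
1-5: by move/eval_inv: h => ->; move/eval_inv: h' => ->.
- move/eval_inv: h => [x [z [h1 h2 ->]]]; move/eval_inv: h' => [x' [z' [h1' h2' ->]]].
  by rewrite (ihc _ _ _ h1 h1') (ihd _ _ _ h2 h2').
- move/eval_inv: h => [x h1 h2]; move/eval_inv: h' => [x' h1' h2'].
  by move: h2'; rewrite -(ihd _ _ _ h1 h1') => /(ihc _ _ _ h2).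
- move: h h'; rewrite -(npair_eta n) => /eval_PrecP[w [w0 wS <-]].
  move=> /eval_PrecP[w' [w'0 w'S <-]].
  have : forall k, k <= nsnd n -> w k = w' k.
    elim=> [_|k ih km]; first exact: ihc w0 w'0.
    apply: ihd (wS _ km) _; rewrite ih ?(ltnW km)//.
    exact: w'S.
  exact.
- move/eval_inv: h => [w h0 hS]; move/eval_inv: h' => [w' h0' hS'].
  (* At the smaller of two distinct results, [c] would output both 0 and a successor. *)
  have [lt|gt|//] := ltngtP y y'.
  + by have := ihc _ _ _ h0 (hS' _ lt).
  + by have := ihc _ _ _ h0' (hS _ gt).
Qed.

(** One code has to work for every oracle, so that these functions can also be used inside programs
    that do query an oracle. *)
Definition rec_fun (psi : nat -> nat) := exists c, forall phi, realizes c phi psi.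

Lemma rec_fun_recursive psi : rec_fun psi -> recursive psi.
Proof. by case=> c h; exists c. Qed.

Lemma rec_ext F G : F =1 G -> rec_fun F -> rec_fun G.
Proof. by move=> e [c h]; exists c => phi n; rewrite -e; exact: h. Qed.

Lemma rec_id : rec_fun (fun x => x).
Proof.
exists (Pair Fst Snd) => phi n; rewrite -{2}(npair_eta n).
by apply: eval_Pair; constructor.
Qed.

Lemma rec_comp F G : rec_fun F -> rec_fun G -> rec_fun (fun x => F (G x)).
Proof.
by move=> [c hc] [d hd]; exists (Comp c d) => phi n; apply: eval_Comp (hd _ _) (hc _ _).
Qed.

Lemma rec_fst F : rec_fun F -> rec_fun (fun x => nfst (F x)).
Proof. by apply: rec_comp; exists Fst => phi n; constructor. Qed.

Lemma rec_snd F : rec_fun F -> rec_fun (fun x => nsnd (F x)).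
Proof. by apply: rec_comp; exists Snd => phi n; constructor. Qed.

Lemma rec_succ F : rec_fun F -> rec_fun (fun x => (F x).+1).
Proof. by apply: rec_comp; exists Succ => phi n; constructor. Qed.

Lemma rec_const k : rec_fun (fun=> k).
Proof.
elim: k => [|k ih]; last exact: rec_succ.
by exists Zero => phi n; constructor.
Qed.

Lemma rec_pair F G : rec_fun F -> rec_fun G ->
  rec_fun (fun x => npair (F x) (G x)).
Proof.
by move=> [c hc] [d hd]; exists (Pair c d) => phi n; apply: eval_Pair (hc _ _) (hd _ _).
Qed.

Lemma rec_iteri (N B : nat -> nat) (G : nat -> nat -> nat -> nat) :
  rec_fun N -> rec_fun B ->
  rec_fun (fun z => G (nfst z) (nfst (nsnd z)) (nsnd (nsnd z))) ->
  rec_fun (fun x => iteri (N x) (G x) (B x)).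
Proof.
move=> recN [b hb] [g hg].
have h : rec_fun (fun z => iteri (nsnd z) (G (nfst z)) (B (nfst z))).
  exists (Prec b g) => phi n; rewrite -{1}(npair_eta n).
  apply/eval_PrecP; exists (fun k => iteri k (G (nfst n)) (B (nfst n))).
  split=> [|k _|//]; first exact: hb.
  have := hg phi (npair (nfst n) (npair k (iteri k (G (nfst n)) (B (nfst n))))).
  by rewrite !(nfst_pair, nsnd_pair).
apply: (rec_ext (fun x => (fun z => iteri (nsnd z) (G (nfst z)) (B (nfst z)))
  (npair x (N x)))) => [x|]; first by rewrite !(nfst_pair, nsnd_pair).
by apply: (rec_comp _ _ h); apply: rec_pair => //; apply: rec_id.
Qed.

Lemma rec_app2 H F G : rec_fun (fun z => H (nfst z) (nsnd z)) ->
  rec_fun F -> rec_fun G -> rec_fun (fun x => H (F x) (G x)).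
Proof.
move=> hH hF hG; apply: (rec_ext (fun x => (fun z => H (nfst z) (nsnd z))
  (npair (F x) (G x)))) => [x|]; first by rewrite nfst_pair nsnd_pair.
by apply: (rec_comp _ _ hH); apply: rec_pair.
Qed.

Lemma rec_add F G : rec_fun F -> rec_fun G -> rec_fun (fun x => F x + G x).
Proof.
move=> hF hG; apply: (rec_ext (fun x => iteri (G x) (fun _ y => y.+1) (F x))).
  by move=> x; elim: (G x) => [|n /= ->]; rewrite ?addn0 ?addnS.
by apply: rec_iteri => //; do ! [apply: rec_succ|apply: rec_snd]; apply: rec_id.
Qed.

Lemma rec_mul F G : rec_fun F -> rec_fun G -> rec_fun (fun x => F x * G x).
Proof.
move=> hF hG; apply: (rec_ext (fun x => iteri (G x) (fun _ y => F x + y) 0)).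
  by move=> x; elim: (G x) => [|n /= ->]; rewrite ?muln0 ?mulnS.
apply: (rec_iteri _ _ (fun x _ y => F x + y)) => //; first exact: rec_const.
apply: rec_add; last by do ! apply: rec_snd; apply: rec_id.
by apply: rec_comp => //; apply: rec_fst; apply: rec_id.
Qed.

Lemma rec_exp F G : rec_fun F -> rec_fun G -> rec_fun (fun x => F x ^ G x).
Proof.
move=> hF hG; apply: (rec_ext (fun x => iteri (G x) (fun _ y => F x * y) 1)).
  by move=> x; elim: (G x) => [|n /= ->]; rewrite ?expn0 ?expnS.
apply: (rec_iteri _ _ (fun x _ y => F x * y)) => //; first exact: rec_const.
apply: rec_mul; last by do ! apply: rec_snd; apply: rec_id.
by apply: rec_comp => //; apply: rec_fst; apply: rec_id.
Qed.

Lemma rec_pred F : rec_fun F -> rec_fun (fun x => (F x).-1).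
Proof.
move=> hF; apply: (rec_ext (fun x => iteri (F x) (fun k _ => k) 0)).
  by move=> x; case: (F x).
apply: rec_iteri => //; first exact: rec_const.
by apply: rec_fst; apply: rec_snd; apply: rec_id.
Qed.

Lemma rec_sub F G : rec_fun F -> rec_fun G -> rec_fun (fun x => F x - G x).
Proof.
move=> hF hG; apply: (rec_ext (fun x => iteri (G x) (fun _ y => y.-1) (F x))).
  by move=> x; elim: (G x) => [|n /= ->]; rewrite ?subn0 ?subnS.
apply: rec_iteri => //; apply: rec_pred; do ! apply: rec_snd; exact: rec_id.
Qed.

Definition rec_bool (b : nat -> bool) := rec_fun (fun x => nat_of_bool (b x)).

Lemma rec_leq F G : rec_fun F -> rec_fun G -> rec_bool (fun x => F x <= G x).
Proof.
move=> hF hG; apply: (rec_ext (fun x => 1 - (F x - G x))).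
  by move=> x; case: leqP => h; lia.
by apply: rec_sub; [exact: rec_const|exact: rec_sub].
Qed.

Lemma rec_neg b : rec_bool b -> rec_bool (fun x => ~~ b x).
Proof.
move=> hb; apply: (rec_ext (fun x => 1 - b x)) => [x|]; first by case: (b x).
by apply: rec_sub => //; apply: rec_const.
Qed.

Lemma rec_and b b' : rec_bool b -> rec_bool b' -> rec_bool (fun x => b x && b' x).
Proof.
move=> hb hb'; apply: (rec_ext (fun x => b x * b' x)); last exact: rec_mul.
by move=> x; case: (b x); case: (b' x).
Qed.

Lemma rec_or b b' : rec_bool b -> rec_bool b' -> rec_bool (fun x => b x || b' x).
Proof.
move=> hb hb'; apply: (rec_ext (fun x => ~~ (~~ b x && ~~ b' x))).
  by move=> x; case: (b x); case: (b' x).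
by apply/rec_neg/rec_and; apply: rec_neg.
Qed.

Lemma rec_xor b b' : rec_bool b -> rec_bool b' -> rec_bool (fun x => b x (+) b' x).
Proof.
move=> hb hb'; apply: (rec_ext (fun x => (b x && ~~ b' x) || (~~ b x && b' x))).
  by move=> x; case: (b x); case: (b' x).
by apply: rec_or; apply: rec_and => //; apply: rec_neg.
Qed.

Lemma rec_if b F G : rec_bool b -> rec_fun F -> rec_fun G ->
  rec_fun (fun x => if b x then F x else G x).
Proof.
move=> hb hF hG; apply: (rec_ext (fun x => b x * F x + (1 - b x) * G x)).
  by move=> x; case: (b x); rewrite ?mul1n ?mul0n ?addn0 ?add0n.
by apply: rec_add; apply: rec_mul => //; apply: rec_sub => //; apply: rec_const.
Qed.

Lemma rec_min F G : rec_fun F -> rec_fun G -> rec_fun (fun x => minn (F x) (G x)).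
Proof.
move=> hF hG; apply: (rec_ext (fun x => if (F x).+1 <= G x then F x else G x)) => //.
by apply: rec_if => //; apply: rec_leq => //; apply: rec_succ.
Qed.

Lemma rec_div F G : (forall x, 0 < G x) -> rec_fun F -> rec_fun G ->
  rec_fun (fun x => F x %/ G x).
Proof.
move=> G0 hF hG.
apply: (rec_ext (fun x => iteri (F x) (fun k y => y + (k.+1 * G x <= F x)) 0)).
  (* The quotient counts the positive multiples of [G x] up to [F x]; after n rounds the count is
     the minimum of n and the quotient. *)
  move=> x; rewrite -[RHS](@minn_idPr (F x) _ _) ?leq_div//.
  elim: {1 3}(F x) => [|n ih] /=; first by rewrite min0n.
  by rewrite ih -leq_divRL//; case: (ltnP n) => h; lia.
apply: (rec_iteri _ _ (fun x k y => y + (k.+1 * G x <= F x))) => //; first exact: rec_const.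
apply: rec_add; first by do ! apply: rec_snd; apply: rec_id.
apply: rec_leq; last by apply: rec_comp => //; apply: rec_fst; apply: rec_id.
apply: rec_mul; last by apply: rec_comp => //; apply: rec_fst; apply: rec_id.
by apply: rec_succ; apply: rec_fst; apply: rec_snd; apply: rec_id.
Qed.

Lemma rec_iterb (N : nat -> nat) (b0 : bool) (G : nat -> nat -> bool -> bool) :
  rec_fun N -> rec_bool (fun z => G (nfst z) (nfst (nsnd z)) (0 < nsnd (nsnd z))) ->
  rec_bool (fun x => iteri (N x) (G x) b0).
Proof.
move=> hN hG.
apply: (rec_ext (fun x => iteri (N x) (fun k y => nat_of_bool (G x k (0 < y))) b0)).
  move=> x; elim: (N x) => //= n ->; congr (nat_of_bool (G _ _ _)).
  by case: (iteri _ _ _).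
by apply: (rec_iteri _ _ (fun x k y => nat_of_bool (G x k (0 < y)))) => //; apply: rec_const.
Qed.

(** Unbounded search is total as soon as a witness exists, and that existence may be proved
    classically. [Mu] stops at output 0, hence the negation of [P]. *)
Lemma rec_search (P : nat -> nat -> bool) :
  rec_bool (fun z => P (nfst z) (nsnd z)) -> (forall x, exists y, P x y) ->
  exists2 M, rec_fun M & forall x, P x (M x).
Proof.
move=> /rec_neg; rewrite /rec_bool => -[c hc] exP; exists (fun x => ex_minn (exP x)) => [|x]; last first.
  by case: (@ex_minnP (P x) (exP x)).
exists (Mu c) => phi x; case: (@ex_minnP (P x) (exP x)) => m Pm mmin.
apply: (@eval_Mu _ _ _ _ (fun=> 0)) => [|k km].
  by have := hc phi (npair x m); rewrite nfst_pair nsnd_pair Pm.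
have := hc phi (npair x k); rewrite nfst_pair nsnd_pair.
by have /negbTE-> : ~~ P x k by apply/negP => /mmin; rewrite leqNgt km.
Qed.

Ltac rec_tac := repeat match goal with
  | |- rec_fun (fun x => x) => exact: rec_id
  | |- rec_fun (fun x => ?k) => exact: (rec_const k)
  | |- rec_fun nfst => exact: (rec_fst _ rec_id)
  | |- rec_fun nsnd => exact: (rec_snd _ rec_id)
  | H : rec_fun ?F |- rec_fun ?F => exact: H
  | |- rec_fun (fun x => npair _ _) => apply: rec_pair
  | |- rec_fun (fun x => nfst _) => apply: rec_fst
  | |- rec_fun (fun x => nsnd _) => apply: rec_snd
  | |- rec_fun (fun x => (_).+1) => apply: rec_succ
  | |- rec_fun (fun x => (_).-1) => apply: rec_pred
  | |- rec_fun (fun x => addn _ _) => apply: rec_add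
  | |- rec_fun (fun x => muln _ _) => apply: rec_mul
  | |- rec_fun (fun x => subn _ _) => apply: rec_sub
  | |- rec_fun (fun x => minn _ _) => apply: rec_min
  | |- rec_fun (fun x => expn _ _) => apply: rec_exp
  | |- rec_fun (fun x => if _ then _ else _) => apply: rec_if
  | |- rec_fun (fun x => nat_of_bool (@?b x)) => change (rec_bool b)
  | |- rec_bool (fun x => leq _ _) => apply: rec_leq
  | |- rec_bool (fun x => andb _ _) => apply: rec_and
  | |- rec_bool (fun x => orb _ _) => apply: rec_or
  | |- rec_bool (fun x => addb _ _) => apply: rec_xor
  | |- rec_bool (fun x => negb _) => apply: rec_neg
  | H : rec_fun ?F |- rec_fun (fun x => ?F _) => apply: (rec_comp _ _ H)
  | H : rec_fun (fun z => ?F (nfst z) (nsnd z)) |- rec_fun (fun x => ?F _ _) =>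
      apply: (rec_app2 _ _ _ H)
  end.

(* [c'] reports, besides the value computed by [c], a bound on the oracle
   queries: the result is unchanged if the oracle is altered from there on. *)
Lemma use_code c : exists c', forall phi n y, eval phi c n y ->
  exists u, forall phi', (forall k, k < u -> phi' k = phi k) ->
    eval phi' c n y /\ eval phi' c' n (npair y u).
Proof.
elim: c => [||||| c [c' hc] d [d' hd]|c [c' hc] d [d' hd]|c [c' hc] d [d' hd]|c [c' hc]].
- exists (Pair Zero Zero) => phi n y /eval_inv->; exists 0 => phi' _.
  by split; repeat constructor.
- exists (Pair Succ Zero) => phi n y /eval_inv->; exists 0 => phi' _.
  by split; repeat constructor.
- exists (Pair Fst Zero) => phi n y /eval_inv->; exists 0 => phi' _.
  by split; repeat constructor.
- exists (Pair Snd Zero) => phi n y /eval_inv->; exists 0 => phi' _.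
  by split; repeat constructor.
- exists (Pair Oracle Succ) => phi n y /eval_inv->.
  by exists n.+1 => phi' agr; rewrite -agr//; split; repeat constructor.
- have [k hk] : rec_fun (fun z => npair (npair (nfst (nfst z)) (nfst (nsnd z)))
    (nsnd (nfst z) + nsnd (nsnd z))) by rec_tac.
  exists (Comp k (Pair c' d')) => phi n y /eval_inv[x [x' [h1 h2 ->]]].
  have [u1 {}h1] := hc _ _ _ h1; have [u2 {}h2] := hd _ _ _ h2.
  exists (u1 + u2) => phi' agr.
  have [|e1 e1'] := h1 phi'; first by move=> i iu; apply: agr; lia.
  have [|e2 e2'] := h2 phi'; first by move=> i iu; apply: agr; lia.
  split; first exact: eval_Pair.
  apply: eval_Comp; first exact: eval_Pair e1' e2'.
  by have := hk phi' (npair (npair x u1) (npair x' u2)); rewrite !(nfst_pair, nsnd_pair).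
- have [k hk] : rec_fun (fun z => npair (nfst (nfst z))
    (nsnd (nfst z) + nsnd (nsnd z))) by rec_tac.
  exists (Comp k (Pair (Comp c' (Comp Fst d')) d')) => phi n y /eval_inv[x h1 h2].
  have [u1 {}h1] := hd _ _ _ h1; have [u2 {}h2] := hc _ _ _ h2.
  exists (u2 + u1) => phi' agr.
  have [|e1 e1'] := h1 phi'; first by move=> i iu; apply: agr; lia.
  have [|e2 e2'] := h2 phi'; first by move=> i iu; apply: agr; lia.
  split; first exact: eval_Comp e1 e2.
  apply: eval_Comp.
    apply: (eval_Pair _ e1'); apply: (eval_Comp _ e2'); apply: (eval_Comp e1').
    by rewrite -{2}(nfst_pair x u1); constructor.
  by have := hk phi' (npair (npair y u2) (npair x u1)); rewrite !(nfst_pair, nsnd_pair).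
- have [k hk] : rec_fun (fun z => npair (nfst (nfst z))
    (nsnd (nfst z) + nsnd (nsnd (nsnd (nsnd z))))) by rec_tac.
  have [r hr] : rec_fun (fun z => npair (nfst z) (npair (nfst (nsnd z))
    (nfst (nsnd (nsnd z))))) by rec_tac.
  have [i hi] := rec_id.
  exists (Prec c' (Comp k (Pair (Comp d' r) i))) => phi n y.
  rewrite -(npair_eta n); move: (nfst n) (nsnd n) => a m {n}.
  (* The bound is made total, with a dummy value from [m] on, so that [choice] applies; [s] then
     adds up the bounds of all rounds. *)
  move=> /eval_PrecP[w [w0 wS <-]].
  have [u0 {}w0] := hc _ _ _ w0.
  have {}wS : forall k, exists u, k < m -> forall phi',
      (forall i, i < u -> phi' i = phi i) ->
      eval phi' d (npair a (npair k (w k))) (w k.+1) /\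
      eval phi' d' (npair a (npair k (w k))) (npair (w k.+1) u).
    move=> j; case: (ltnP j m) => jm; last by exists 0.
    by have [u hu] := hd _ _ _ (wS _ jm); exists u.
  have [u hu] := choice wS.
  pose s := fix s j := if j is j'.+1 then u j' + s j' else u0.
  have su0 j : u0 <= s j by elim: j => //= j; lia.
  have su j j' : j < j' -> u j <= s j'.
    elim: j' => //= j' ih; rewrite ltnS leq_eqVlt => /predU1P[->|/ih]; lia.
  exists (s m) => phi' agr.
  have [|e0 e0'] := w0 phi'; first by move=> j ju; apply: agr; have := su0 m; lia.
  have e j : j < m -> eval phi' d (npair a (npair j (w j))) (w j.+1) /\
      eval phi' d' (npair a (npair j (w j))) (npair (w j.+1) (u j)).
    by move=> jm; apply: hu => // l lu; apply: agr; have := su _ _ jm; lia.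
  split; apply/eval_PrecP.
    by exists w; split=> // j /e[].
  exists (fun j => npair (w j) (s j)); split=> // j jm.
  have [_ ej] := e j jm.
  apply: eval_Comp.
    apply: (eval_Pair _ (hi _ _)); apply: (eval_Comp (hr _ _)).
    rewrite !(nfst_pair, nsnd_pair); exact: ej.
  by have := hk phi' (npair (npair (w j.+1) (u j)) (npair a (npair j (npair (w j) (s j)))));
    rewrite !(nfst_pair, nsnd_pair).
- have [k hk] : rec_fun (fun z => nsnd (nfst z) + nsnd (nsnd (nsnd z))) by rec_tac.
  have [r hr] : rec_fun (fun z => npair (nfst z) (nfst (nsnd z))) by rec_tac.
  have [i hi] := rec_id.
  pose c1 := Mu (Comp Fst c').
  (* [Mu] returns only the index found, so a recursion of length [y.+1] reruns the tests 0, ..., [y]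
     to add up their bounds. *)
  exists (Pair c1 (Comp (Prec Zero (Comp k (Pair (Comp c' r) i))) (Pair i (Comp Succ c1)))).
  move=> phi n y /eval_inv[w h0 hS].
  pose W j := if j < y then (w j).+1 else 0.
  have : forall j, exists u, j <= y -> forall phi',
      (forall i, i < u -> phi' i = phi i) ->
      eval phi' c (npair n j) (W j) /\
      eval phi' c' (npair n j) (npair (W j) u).
    move=> j; case: (leqP j y) => jy; last by exists 0.
    have : eval phi c (npair n j) (W j).
      rewrite /W; case: ltnP => [/hS//|yj].
      by have -> : j = y by lia.
    by move=> /hc[u hu]; exists u.
  move=> /choice[u hu].
  pose s := fix s j := if j is j'.+1 then u j' + s j' else 0.
  have su j j' : j < j' -> u j <= s j'.
    elim: j' => //= j' ih; rewrite ltnS leq_eqVlt => /predU1P[->|/ih]; lia.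
  exists (s y.+1) => phi' agr.
  have e j : j <= y -> eval phi' c (npair n j) (W j) /\
      eval phi' c' (npair n j) (npair (W j) (u j)).
    by move=> jm; apply: hu => // l lu; apply: agr; have := su j y.+1 jm; lia.
  have e1 : eval phi' c1 n y.
    apply: (@eval_Mu _ _ _ _ w) => [|j jy].
      have [_ ey] := e y (leqnn y); apply: (eval_Comp ey).
      have -> : 0 = nfst (npair (W y) (u y)) by rewrite nfst_pair /W ltnn.
      by constructor.
    have [_ ey] := e j (ltnW jy); apply: (eval_Comp ey).
    have -> : (w j).+1 = nfst (npair (W j) (u j)) by rewrite nfst_pair /W jy.
    by constructor.
  split.
    apply: (@eval_Mu _ _ _ _ w) => [|j jy].
      by have [] := e y (leqnn y); rewrite /W ltnn.
    by have [] := e j (ltnW jy); rewrite /W jy.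
  apply: (eval_Pair e1); apply: eval_Comp.
    by apply: (eval_Pair (hi _ _)); apply: (eval_Comp e1); constructor.
  apply/eval_PrecP; exists s; split=> //; first by constructor.
  move=> j jy; have [_ ej] := e j jy.
  apply: eval_Comp.
    apply: (eval_Pair _ (hi _ _)); apply: (eval_Comp (hr _ _)).
    rewrite !(nfst_pair, nsnd_pair); exact: ej.
  by have := hk phi' (npair (npair (W j) (u j)) (npair n (npair j (s j))));
    rewrite !(nfst_pair, nsnd_pair).
Qed.

(* Inlining of an oracle that is itself computed by [s], with parameter [e]. *)
Lemma subst_code c s : exists c', forall phi0 e phi,
  (forall k, eval phi0 s (npair e k) (phi k)) ->
  forall n y, eval phi c n y -> eval phi0 c' (npair e n) y.
Proof.
elim: c => [||||| c [c' hc] d [d' hd]|c [c' hc] d [d' hd]|c [c' hc] d [d' hd]|c [c' hc]].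
- by exists Zero => phi0 e phi hs n y /eval_inv->; constructor.
- exists (Comp Succ Snd) => phi0 e phi hs n y /eval_inv->.
  by apply: eval_Comp; [exact: eval_Snd|rewrite nsnd_pair; constructor].
- exists (Comp Fst Snd) => phi0 e phi hs n y /eval_inv->.
  by apply: eval_Comp; [exact: eval_Snd|rewrite nsnd_pair; constructor].
- exists (Comp Snd Snd) => phi0 e phi hs n y /eval_inv->.
  by apply: eval_Comp; [exact: eval_Snd|rewrite nsnd_pair; constructor].
- by exists s => phi0 e phi hs n y /eval_inv->.
- exists (Pair c' d') => phi0 e phi hs n y /eval_inv[x [x' [h1 h2 ->]]].
  by apply: eval_Pair; [apply: hc h1|apply: hd h2].
- exists (Comp c' (Pair Fst d')) => phi0 e phi hs n y /eval_inv[x h1 h2].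
  apply: eval_Comp; last by apply: hc h2.
  apply: eval_Pair; last by apply: hd h1.
  by rewrite -{2}(nfst_pair e n); constructor.
- have [r hr] : rec_fun (fun z => npair (npair (nfst z) (nfst (nsnd z)))
    (nsnd (nsnd z))) by rec_tac.
  have [r' hr'] : rec_fun (fun z => npair (nfst (nfst z))
    (npair (nsnd (nfst z)) (nsnd z))) by rec_tac.
  (* [r] regroups the input so that [e] joins the recursion parameter, and [r'] restores the shape
     that [d'] expects. *)
  exists (Comp (Prec c' (Comp d' r')) r) => phi0 e phi hs n y.
  rewrite -{1}(npair_eta n) => /eval_PrecP[w [w0 wS <-]].
  apply: (eval_Comp (hr _ _)); rewrite !(nfst_pair, nsnd_pair).
  apply/eval_PrecP; exists w; split => //; first by apply: hc w0.
  move=> k km; apply: (eval_Comp (hr' _ _)); rewrite !(nfst_pair, nsnd_pair).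
  by apply: hd (wS _ km).
- have [r' hr'] : rec_fun (fun z => npair (nfst (nfst z))
    (npair (nsnd (nfst z)) (nsnd z))) by rec_tac.
  exists (Mu (Comp c' r')) => phi0 e phi hs n y /eval_inv[w h0 hS].
  apply: (@eval_Mu _ _ _ _ w) => [|k ky]; apply: (eval_Comp (hr' _ _));
    rewrite !(nfst_pair, nsnd_pair).
    exact: hc h0.
  exact: hc (hS _ ky).
Qed.

Local Open Scope ring_scope.

(** * Uniform approximation of computable functions *)

(** The predecessor compensates for the denominator [(nsnd n).+1] in [nuQ]. *)
Definition dyadic_code (k i : nat) : nat := npair (npair i 0) (2 ^ k).-1.

Lemma pow2_gt0 (R : numDomainType) k : 0 < 2 ^+ k :> R.
Proof. exact: exprn_gt0. Qed.

Lemma ratr_dyadic_code (R : realType) k i :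
  ratr (nuQ (dyadic_code k i)) = i%:R / 2 ^+ k :> R.
Proof.
rewrite /nuQ /dyadic_code !nfst_pair !nsnd_pair subr0 prednK ?expn_gt0//.
by rewrite fmorph_div /= !ratr_nat natrX.
Qed.

(** Closed at both ends, so that a grid point lies in both adjacent cells and an approximation valid
    on a cell holds at its two ends. *)
Definition cell (R : realType) (m j : nat) (x : R) : Prop :=
  j%:R <= x * 2 ^+ m <= j.+1%:R.

Lemma cell_coarsen (R : realType) m k j (x : R) : (k <= m)%N -> cell R m j x ->
  cell R k (j %/ 2 ^ (m - k)) x.
Proof.
move=> km /andP[h1 h2]; set P := (2 ^ (m - k))%N.
have P0 : (0 < P)%N by rewrite expn_gt0.
have PR : 0 < P%:R :> R by rewrite ltr0n.
have e : 2 ^+ m = 2 ^+ k * P%:R :> R by rewrite /P natrX -exprD subnKC.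
have a : (j %/ P * P <= j)%N by apply: leq_trunc_div.
have b : (j.+1 <= (j %/ P).+1 * P)%N by apply: ltn_ceil.
move: a b; rewrite -(ler_nat R) -[(_ <= _ * _)%N](ler_nat R) !natrM => a b.
rewrite /cell -(ler_pM2r PR) -[_ * _ <= (_).+1%:R](ler_pM2r PR) -mulrA -e.
by rewrite (le_trans a h1) (le_trans h2 b).
Qed.

Lemma cell_point (R : realType) m j k :
  cell R k (j * 2 ^ k %/ 2 ^ m) (j%:R / 2 ^+ m).
Proof.
have P0 : (0 < 2 ^ m)%N by rewrite expn_gt0.
have := leq_trunc_div (j * 2 ^ k) (2 ^ m).
have := ltn_ceil (j * 2 ^ k) P0.
rewrite -(ler_nat R) -[(_ <= _ * _)%N](ler_nat R) !natrM !natrX => b a.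
rewrite /cell mulrAC ler_pdivlMr ?pow2_gt0// a ler_pdivrMr ?pow2_gt0//.
by apply: le_trans b; rewrite -natrX -natrM ler_nat.
Qed.

Lemma cell_name (R : realType) k i (x : R) : cell R k i x ->
  `|x - ratr (nuQ (dyadic_code k i))| <= 2 ^- k.
Proof.
rewrite ratr_dyadic_code => /andP[h1 h2].
have P0 := pow2_gt0 R k.
have e : x = x * 2 ^+ k / 2 ^+ k by rewrite mulfK ?gt_eqF.
rewrite e -mulrBl normrM [`|_^-1|]gtr0_norm ?invr_gt0//.
rewrite -[leRHS]mul1r ler_pM2r ?invr_gt0// ler_norml.
by move: h1 h2; rewrite -addn1 natrD; lra.
Qed.

Lemma cell_exists (R : realType) k (x : R) : 0 <= x -> exists i, cell R k i x.
Proof.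
move=> x0; exists (Num.truncn (x * 2 ^+ k)).
have /truncn_itv/andP[h1 h2] : 0 <= x * 2 ^+ k by rewrite mulr_ge0 ?exprn_ge0.
by rewrite /cell h1 ltW.
Qed.

Definition dyadic_path (J : nat -> nat) :=
  forall k, J k.+1 = (J k).*2 \/ J k.+1 = (J k).*2.+1.

Lemma dyadic_path_div J k d : dyadic_path J -> (J (k + d) %/ 2 ^ d)%N = J k.
Proof.
move=> JS; elim: d => [|d ih]; first by rewrite addn0 divn1.
by rewrite addnS expnS divnMA -ih; congr (_ %/ _)%N; case: (JS (k + d)%N) => ->; lia.
Qed.

(** The point is the supremum of the left ends of the nested cells. The second property serves to
    show x <= 1, which the cells alone do not give when [J k] may equal [2 ^ k]. *)
Lemma dyadic_path_point (R : realType) J : dyadic_path J ->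
  exists2 x : R, forall k, cell R k (J k) x &
    forall y, (forall k, (J k)%:R <= y * 2 ^+ k) -> x <= y.
Proof.
move=> JS; pose a k : R := (J k)%:R / 2 ^+ k; pose b k : R := (J k).+1%:R / 2 ^+ k.
have ab k l : a k <= b l.
  have [kl|lk] := leqP k l.
    apply: (@le_trans _ _ (a l)); last by rewrite ler_pM2r ?invr_gt0 ?pow2_gt0// ler_nat.
    rewrite /a ler_pdivlMr ?pow2_gt0// mulrAC ler_pdivrMr ?pow2_gt0//.
    have := leq_trunc_div (J l) (2 ^ (l - k)).
    have := dyadic_path_div J k (l - k) JS; rewrite subnKC// => -> h.
    have e : (2 ^ l = 2 ^ k * 2 ^ (l - k))%N by rewrite -expnD subnKC.
    by rewrite -!natrX -!natrM ler_nat e mulnCA mulnC leq_mul2r h orbT.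
  apply: (@le_trans _ _ (b k)); first by rewrite ler_pM2r ?invr_gt0 ?pow2_gt0// ler_nat.
  rewrite /b ler_pdivlMr ?pow2_gt0// mulrAC ler_pdivrMr ?pow2_gt0//.
  have P0 : (0 < 2 ^ (k - l))%N by rewrite expn_gt0.
  have := ltn_ceil (J k) P0.
  have := dyadic_path_div J l (k - l) JS; rewrite subnKC ?(ltnW lk)// => -> h.
  have e : (2 ^ k = 2 ^ l * 2 ^ (k - l))%N by rewrite -expnD subnKC ?(ltnW lk).
  by rewrite -!natrX -!natrM ler_nat e mulnCA [leqRHS]mulnC leq_mul2r h orbT.
have ne : range a !=set0 by exists (a 0%N), 0%N.
have hs : has_sup (range a) by split=> //; exists (b 0%N) => _ [k _ <-].
exists (sup (range a)) => [k|y yub].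
  apply/andP; split.
    by rewrite -ler_pdivrMr ?pow2_gt0//; apply: (ub_le_sup (proj2 hs)); exists k.
  by rewrite -ler_pdivlMr ?pow2_gt0//; apply: ge_sup => // _ [l _ <-]; apply: ab.
by apply: ge_sup => // _ [k _ <-]; rewrite ler_pdivrMr ?pow2_gt0.
Qed.

Lemma div_le_pow2 m k j : (k <= m)%N -> (j <= 2 ^ m)%N -> (j %/ 2 ^ (m - k) <= 2 ^ k)%N.
Proof.
move=> km jm; rewrite -ltnS ltn_divLR ?expn_gt0// mulSn -expnD subnKC//.
by rewrite -addn1 addnC leq_add ?expn_gt0.
Qed.

(** [j m] is a node of depth m, and [P k i] says that infinitely many of these nodes lie below node
    [i] of depth k. By pigeonhole one child inherits the property. There are two roots, 0 and 1,
    because [j m = 2 ^ m] is allowed. *)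
Lemma koenig_path (j : nat -> nat) : (forall m, j m <= 2 ^ m)%N ->
  exists2 J, dyadic_path J & forall k N, exists m,
    [/\ (N <= m)%N, (k <= m)%N & (j m %/ 2 ^ (m - k))%N = J k].
Proof.
move=> jle; pose P k i := forall N, exists m,
  [/\ (N <= m)%N, (k <= m)%N & (j m %/ 2 ^ (m - k))%N = i].
have P0 : P 0%N 0%N \/ P 0%N 1%N.
  apply: contrapT => /not_orP[/existsNP[N1 h1] /existsNP[N2 h2]].
  set m := maxn N1 N2.
  have : (j m %/ 2 ^ (m - 0) <= 1)%N.
    exact: div_le_pow2.
  case e : (j m %/ 2 ^ (m - 0))%N => [|[|//]] _.
    by apply: h1; exists m; rewrite e leq_maxl.
  by apply: h2; exists m; rewrite e leq_maxr.
have PS k i : P k i -> P k.+1 i.*2 \/ P k.+1 i.*2.+1.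
  move=> Pk; apply: contrapT => /not_orP[/existsNP[N1 h1] /existsNP[N2 h2]].
  have [m [mN km e]] := Pk (N1 + N2 + k.+1)%N.
  set i' := (j m %/ 2 ^ (m - k.+1))%N.
  have ei : (i' %/ 2)%N = i.
    by rewrite -e /i' -divnMA -expnSr; congr (_ %/ 2 ^ _)%N; lia.
  have [ev|od] : i' = i.*2 \/ i' = i.*2.+1 by lia.
    by apply: h1; exists m; rewrite -/i' ev; split => //; lia.
  by apply: h2; exists m; rewrite -/i' od; split => //; lia.
pose nxt k i := if pselect (P k.+1 i.*2) then i.*2 else i.*2.+1.
pose J := fix J k := if k is k'.+1 then nxt k' (J k')
  else if pselect (P 0%N 0%N) then 0%N else 1%N.
exists J => k; first by rewrite /= /nxt; case: pselect => ?; [left|right].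
suff : P k (J k) by [].
elim: k => [|k ih] /=; first by case: pselect => // ?; case: P0.
by rewrite /nxt; case: pselect => // ?; case: (PS _ _ ih).
Qed.

(** Integer part of 2^n times the rational coded by [q], with negative rationals replaced by 0. *)
Definition trunc_code (n q : nat) : nat :=
  ((nfst (nfst q) - nsnd (nfst q)) * 2 ^ n %/ (nsnd q).+1)%N.

Lemma trunc_codeP (R : realType) n q (y : R) : 0 <= y ->
  `|y - ratr (nuQ q)| <= 2 ^- n -> `|y * 2 ^+ n - (trunc_code n q)%:R| <= 2.
Proof.
rewrite /nuQ /trunc_code; move: (nfst (nfst q)) (nsnd (nfst q)) (nsnd q) => i j k y0.
rewrite fmorph_div rmorphB /= !ratr_nat.
have k0 : 0 < k.+1%:R :> R by rewrite ltr0n.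
have P0 := pow2_gt0 R n.
set d := (i - j)%N => h.
have {}h : `|y - d%:R / k.+1%:R| <= 2 ^- n.
  have [ij|ji] := leqP j i; first by rewrite natrB.
  have d0 : d = 0%N by rewrite /d; lia.
  (* Since y >= 0, raising a nonpositive rational to 0 only brings it closer to y. *)
  rewrite d0 mul0r subr0 ger0_norm//; apply: le_trans h.
  rewrite ger0_norm; last first.
    rewrite subr_ge0; apply: le_trans y0.
    by rewrite pmulr_lle0 ?invr_gt0// subr_le0 ler_nat ltnW.
  by rewrite lerDl oppr_ge0 pmulr_lle0 ?invr_gt0// subr_le0 ler_nat ltnW.
have {}h : `|y * 2 ^+ n - d%:R / k.+1%:R * 2 ^+ n| <= 1.
  by rewrite -mulrBl normrM (gtr0_norm P0) -ler_pdivlMr// mul1r.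
have t1 := leq_trunc_div (d * 2 ^ n) k.+1; have t2 := ltn_ceil (d * 2 ^ n) (ltn0Sn k).
move: t1 t2; set t := (_ %/ _)%N => t1 /ltnW t2.
have {}t1 : t%:R * k.+1%:R <= d%:R * 2 ^+ n :> R by rewrite -natrX -!natrM ler_nat.
have {}t2 : d%:R * 2 ^+ n <= t.+1%:R * k.+1%:R :> R.
  by rewrite -natrX -!natrM ler_nat.
have e : d%:R / k.+1%:R * 2 ^+ n * k.+1%:R = d%:R * 2 ^+ n :> R.
  by rewrite mulrAC divfK ?gt_eqF.
have u1 : t%:R <= d%:R / k.+1%:R * 2 ^+ n :> R by rewrite -(ler_pM2r k0) e.
have u2 : d%:R / k.+1%:R * 2 ^+ n <= t%:R + 1 :> R.
  by rewrite natr1 -(ler_pM2r k0) e.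
move: h u1 u2; rewrite !ler_norml; set z := _ / _ * _.
by move=> /andP[h1 h2] u1 u2; apply/andP; split; lra.
Qed.

Lemma iteri_all (P : nat -> bool) N :
  reflect (forall k, (k < N)%N -> P k) (iteri N (fun k b => b && P k) true).
Proof.
elim: N => [|N ih] /=; first by apply: ReflectT.
apply: (iffP andP) => [[/ih h PN] k|h].
  by rewrite ltnS leq_eqVlt => /predU1P[->//|/h].
by split; [apply/ih => k kN; apply: h; lia|apply: h].
Qed.

(** A name of j / 2^m for [e = npair m j]. Capping j at 2^m keeps the point in [0;1], so that a
    program run on it halts for every [e]. *)
Definition trunc_name (e k : nat) : nat :=
  dyadic_code k (minn (nsnd e) (2 ^ nfst e) * 2 ^ k %/ 2 ^ nfst e).

Lemma rec_dyadic_code F G : rec_fun F -> rec_fun G ->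
  rec_fun (fun x => dyadic_code (F x) (G x)).
Proof. by move=> hF hG; rewrite /dyadic_code; rec_tac. Qed.

(* The computation on the dyadic point j / 2^m is valid on the whole cell
   [j / 2^m, (j + 1) / 2^m] if it queries its name only up to level m, since
   every point of the cell has a name that starts in the same way.  By Koenig's
   lemma there is an m that works for all j, and it is found by search. *)
Lemma uniform_approx (R : realType) (h : R -> R) :
  (forall x : R, 0 <= x <= 1 -> 0 <= h x) -> computable_on `[0, 1] h ->
  exists M D, [/\ rec_fun M,
    rec_fun (fun z => D (nfst z) (nfst (nsnd z)) (nsnd (nsnd z))) &
    forall n m j (x : R), (M n <= m)%N -> (j <= 2 ^ m)%N -> cell R m j x -> 0 <= x <= 1 ->
      `|h x * 2 ^+ n - (D n m j)%:R| <= 2].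
Proof.
move=> h0 [c hc].
have [c1 hc1] := use_code c.
have [s hs] : rec_fun (fun z => trunc_name (nfst z) (nsnd z)).
  apply: rec_dyadic_code; first exact: rec_snd rec_id.
  by apply: rec_div; [move=> x; rewrite expn_gt0|rec_tac|rec_tac].
have [c2 hc2] := subst_code c1 s.
have hs' phi0 e k : eval phi0 s (npair e k) (trunc_name e k).
  by have := hs phi0 (npair e k); rewrite nfst_pair nsnd_pair.
have halt (x : R) phi n : 0 <= x <= 1 -> name_of phi x -> exists y u,
    `|h x - ratr (nuQ y)| <= 2 ^- n /\
    forall phi', (forall k, (k < u)%N -> phi' k = phi k) ->
      eval phi' c n y /\ eval phi' c1 n (npair y u).
  move=> x01 phix; have [|psi cpsi psix] := hc x _ phi phix; first by rewrite /= in_itv.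
  by have [u hu] := hc1 _ _ _ (cpsi n); exists (psi n), u; split=> //; apply: psix.
have nameP m j : (j <= 2 ^ m)%N -> name_of (trunc_name (npair m j)) (j%:R / 2 ^+ m : R).
  move=> jm k; apply: cell_name; rewrite nfst_pair nsnd_pair (minn_idPl jm).
  exact: cell_point.
have pt01 m j : (j <= 2 ^ m)%N -> 0 <= (j%:R / 2 ^+ m : R) <= 1.
  move=> jm; rewrite divr_ge0 ?exprn_ge0//= ler_pdivrMr ?pow2_gt0// mul1r -natrX.
  by rewrite ler_nat.
have min_name e : trunc_name e = trunc_name (npair (nfst e) (minn (nsnd e) (2 ^ nfst e))).
  by apply/funext => k; rewrite /trunc_name !nfst_pair !nsnd_pair -minnA minnn.
have : forall z, exists w, forall phi',
    (forall k, (k < nsnd w)%N -> phi' k = trunc_name (nfst z) k) ->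
    eval phi' c (nsnd z) (nfst w) /\ eval phi' c1 (nsnd z) w.
  move=> z; rewrite min_name.
  have jm := geq_minr (nsnd (nfst z)) (2 ^ nfst (nfst z)).
  have [y [u [_ hu]]] := halt _ _ (nsnd z) (pt01 _ _ jm) (nameP _ _ jm).
  by exists (npair y u); rewrite nfst_pair nsnd_pair.
move=> /choice[V hV].
have recV : rec_fun V.
  exists c2 => phi0 z; rewrite -{1}(npair_eta z).
  apply: (hc2 _ _ (trunc_name (nfst z))) => //.
  by have [] := hV z (trunc_name (nfst z)) (fun _ _ => erefl).
pose use m n j := nsnd (V (npair (npair m j) n)).
(* Queries below [m.+1] concern levels 0, ..., m, which is where all points of a cell of level m can
   share a name. *)
pose good n m := iteri (2 ^ m).+1 (fun j b => b && (use m n j <= m.+1)%N) true.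
have goodP n m : reflect (forall j, (j <= 2 ^ m)%N -> (use m n j <= m.+1)%N) (good n m).
  by apply: (iffP (iteri_all _ _)) => g j; [rewrite -ltnS|rewrite ltnS]; apply: g.
have recG : rec_bool (fun z => good (nfst z) (nsnd z)).
  apply: (rec_iterb _ _ (fun z j b => b && (use (nsnd z) (nfst z) j <= (nsnd z).+1)%N)).
    by rec_tac.
  by rewrite /use; rec_tac.
have exG n : exists m, good n m.
  apply: contrapT => /forallNP ng.
  have : forall m, exists j, (j <= 2 ^ m)%N /\ (m.+1 < use m n j)%N.
    move=> m; apply: contrapT => /forallNP bj; apply: (ng m); apply/goodP => j jm.
    by rewrite leqNgt; apply/negP => lt; apply: (bj j).
  move=> /choice[j hj].
  (* If every level had a bad point, the branch through them would name a real x. The program halts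
     on that name with some bound u, and a bad point below the node [J u] shares its first u
     entries, so its own bound is u, which is too small to be bad. *)
  have [J JS hJ] := koenig_path j (fun m => (hj m).1).
  have [x xJ xlub] := dyadic_path_point R J JS.
  have x01 : 0 <= x <= 1.
    have := xJ 0%N; rewrite /cell expr0 mulr1 => /andP[x0 _]; rewrite (le_trans _ x0)//=.
    apply: xlub => k; have [m [_ km <-]] := hJ k 0%N.
    by rewrite mul1r -natrX ler_nat div_le_pow2 ?(hj m).1.
  have xname : name_of (fun k => dyadic_code k (J k)) x by move=> k; apply: cell_name.
  have [y [u [_ hu]]] := halt _ _ n x01 xname.
  have [m [_ um ej]] := hJ u 0%N.
  have [jm lt] := hj m.
  have agr k : (k < u)%N -> trunc_name (npair m (j m)) k = dyadic_code k (J k).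
    move=> ku; rewrite /trunc_name nfst_pair nsnd_pair (minn_idPl jm); congr dyadic_code.
    have km : (k <= m)%N by lia.
    rewrite -{2}(subnK km) expnD divnMr ?expn_gt0//.
    rewrite -(dyadic_path_div J k (u - k) JS) subnKC ?(ltnW ku)// -ej -divnMA -expnD.
    by congr (_ %/ 2 ^ _)%N; lia.
  have [_ e1] := hu _ agr.
  have [_ e2] := hV (npair (npair m (j m)) n) _ (fun _ _ => erefl).
  move: e2; rewrite nfst_pair nsnd_pair => e2.
  have := eval_fun _ _ _ _ _ e1 e2 => eV.
  by move: lt; rewrite /use -eV nsnd_pair; lia.
have [M recM hM] := rec_search (fun n m => good n m) recG exG.
(* The cell is first coarsened to level [M n], so that every finer level works too. *)
pose val n m j := nfst (V (npair (npair (M n) (j %/ 2 ^ (m - M n))) n)).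
exists M, (fun n m j => trunc_code n (val n m j)); split=> //.
  have rv : rec_fun (fun z => val (nfst z) (nfst (nsnd z)) (nsnd (nsnd z))).
    rewrite /val; apply: rec_fst; apply: (rec_comp _ _ recV).
    apply: rec_pair; last by rec_tac.
    apply: rec_pair; first by rec_tac.
    by apply: rec_div; [move=> x; rewrite expn_gt0|rec_tac|rec_tac].
  by rewrite /trunc_code; apply: rec_div => //; rec_tac.
move=> n m j x Mm jm xc x01; apply: trunc_codeP; first exact: h0.
set m0 := M n; set j0 := (j %/ 2 ^ (m - m0))%N.
have j0m : (j0 <= 2 ^ m0)%N by exact: div_le_pow2.
have x0 : cell R m0 j0 x by apply: cell_coarsen.
have /goodP/(_ _ j0m) := hM n; rewrite -/m0 => hu.
have [nu hnu] := choice (fun k => cell_exists R k x (proj1 (andP x01))).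
(* A name of x that agrees with the name of the dyadic point as far as the program looks. *)
pose phi k := if (k <= m0)%N then trunc_name (npair m0 j0) k else dyadic_code k (nu k).
have phix : name_of phi x.
  move=> k; rewrite /phi; case: leqP => km; last exact: cell_name.
  rewrite /trunc_name nfst_pair nsnd_pair (minn_idPl j0m); apply: cell_name.
  by rewrite -{1}(subnK km) expnD divnMr ?expn_gt0//; apply: cell_coarsen.
have [y [u [xy hy]]] := halt _ _ n x01 phix.
have [ey _] := hy _ (fun _ _ => erefl).
have [|ev _] := hV (npair (npair m0 j0) n) phi.
  move=> k kV; rewrite nfst_pair /phi ifT// -ltnS; exact: leq_trans kV hu.
move: ev; rewrite nsnd_pair => ev.
by rewrite /val -/m0 -/j0 -(eval_fun _ _ _ _ _ ey ev).
Qed.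

(** * Images of computable reals and uniform continuity *)

Lemma computable_image (R : realType) (h : R -> R) (x : R) :
  computable_on `[0, 1] h -> 0 <= x <= 1 -> computable_real x ->
  computable_real (h x).
Proof.
move=> [c hc] x01 [phi [d hd] phix].
have [|psi hpsi psix] := hc x _ phi phix; first by rewrite /= in_itv.
exists psi => //; have [c' hc'] := subst_code c (Comp d Snd).
have [i hi] := rec_id.
exists (Comp c' (Pair Zero i)) => n; apply: eval_Comp.
  by apply: (eval_Pair _ (hi _ n)); constructor.
apply: (hc' _ _ phi) => [k|]; last exact: hpsi.
apply: (eval_Comp _ (hd k)).
by rewrite -{2}(nsnd_pair 0 k); constructor.
Qed.

Lemma cell_exists_le (R : realType) m (x : R) : 0 <= x <= 1 ->
  exists2 j, (j <= 2 ^ m)%N & cell R m j x.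
Proof.
move=> /andP[x0 x1]; have P0 := pow2_gt0 R m.
exists (Num.truncn (x * 2 ^+ m)); have /truncn_itv/andP[h1 h2] : 0 <= x * 2 ^+ m
  by rewrite mulr_ge0 ?exprn_ge0.
  rewrite -(ler_nat R) natrX (le_trans h1)//.
  by rewrite -[leRHS]mul1r ler_pM2r.
by rewrite /cell h1 ltW.
Qed.

Lemma exists_pow2_ge (R : realType) (y : R) : exists n, y <= 2 ^+ n.
Proof.
exists (Num.truncn `|y|).+1.
have /truncn_itv/andP[_ h] := normr_ge0 y.
apply: le_trans (ler_norm y) _; apply: le_trans (ltW h) _.
by rewrite -natrX ler_nat ltnW// ltn_expl.
Qed.

(** Points at distance at most 2^-m lie in one cell or in adjacent ones. Sharing an approximation
    costs 2 + 2 within a cell; passing through the common end point doubles this to 8, in units of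
    2^-n. *)
Lemma computable_ucont (R : realType) (h : R -> R) (e : R) :
  (forall x : R, 0 <= x <= 1 -> 0 <= h x) -> computable_on `[0, 1] h -> 0 < e ->
  exists m, forall x y : R, 0 <= x <= 1 -> 0 <= y <= 1 ->
    `|x - y| * 2 ^+ m <= 1 -> `|h x - h y| <= e.
Proof.
move=> h0 hC e0; have [M [D [_ _ hD]]] := uniform_approx R h h0 hC.
have [n hn] := exists_pow2_ge R (8 / e); exists (M n).
set m := M n; have P0 := pow2_gt0 R m; have Q0 := pow2_gt0 R n.
suff le_case (x y : R) : 0 <= x <= 1 -> 0 <= y <= 1 -> x <= y ->
    (y - x) * 2 ^+ m <= 1 -> `|h x - h y| <= e.
  move=> x y x01 y01; have [xy|/ltW yx] := leP x y.
    by rewrite distrC ger0_norm ?subr_ge0//; apply: le_case.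
  by rewrite ger0_norm ?subr_ge0// distrC; apply: le_case.
move=> x01 y01 xy d.
have [j jm jx] := cell_exists_le R m x x01.
have near2 i (a b : R) : (i <= 2 ^ m)%N -> cell R m i a -> cell R m i b ->
    0 <= a <= 1 -> 0 <= b <= 1 -> `|h a * 2 ^+ n - h b * 2 ^+ n| <= 4.
  move=> im ia ib a01 b01.
  have := hD n m i a (leqnn _) im ia a01; have := hD n m i b (leqnn _) im ib b01.
  by rewrite !ler_norml => /andP[? ?] /andP[? ?]; apply/andP; split; lra.
suff h8 : `|h x * 2 ^+ n - h y * 2 ^+ n| <= 8.
  rewrite -(ler_pM2r Q0) -[X in _ * X <= _](gtr0_norm Q0) -normrM mulrBl.
  by apply: le_trans h8 _; rewrite mulrC -ler_pdivrMr.
have jx2 := jx; move: jx2 => /andP[jx1 jx2].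
have [yj|yj] := leP (y * 2 ^+ m) j.+1%:R.
  have jy : cell R m j y.
    by rewrite /cell yj andbT (le_trans jx1)// ler_pM2r.
  by apply: le_trans (near2 j x y jm jx jy x01 y01) _; lra.
have j1m : (j.+1 <= 2 ^ m)%N.
  rewrite -(ler_nat R) natrX (le_trans (ltW yj))// -[leRHS]mul1r ler_pM2r//.
  by case/andP: y01.
pose z : R := j.+1%:R / 2 ^+ m.
have ze : z * 2 ^+ m = j.+1%:R by rewrite /z divfK ?gt_eqF.
have z01 : 0 <= z <= 1.
  by rewrite divr_ge0 ?exprn_ge0//= ler_pdivrMr// mul1r -natrX ler_nat.
have jz : cell R m j z by rewrite /cell ze lexx ler_nat leqnSn.
have jz' : cell R m j.+1 z by rewrite /cell ze lexx ler_nat leqnSn.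
have jy' : cell R m j.+1 y.
  by rewrite /cell (ltW yj) /=; move: d jx2; rewrite mulrBl -(natr1 j.+1); lra.
have := near2 j x z jm jx jz x01 z01; have := near2 j.+1 z y j1m jz' jy' z01 y01.
by rewrite !ler_norml => /andP[? ?] /andP[? ?]; apply/andP; split; lra.
Qed.

Lemma ucont_within (R : realType) (h : R -> R) :
  (forall e, 0 < e -> exists m, forall x y : R, 0 <= x <= 1 -> 0 <= y <= 1 ->
    `|x - y| * 2 ^+ m <= 1 -> `|h x - h y| <= e) ->
  {within `[0, 1], continuous h}.
Proof.
move=> hu; apply/subspace_continuousP => x /=; rewrite in_itv /= => x01.
apply/cvgrPdist_le => e e0; have [m hm] := hu e e0.
have P0 := pow2_gt0 R m.
rewrite near_withinE; apply/nbhs_ballP; exists (2 ^- m); first by rewrite /= invr_gt0.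
move=> t /= xt; rewrite in_itv /= => t01; apply: hm => //.
by rewrite -ler_pdivlMr// mul1r ltW.
Qed.

(** * Parity of crossings *)

Definition edge (p q p' q' : bool) := [&& p, p' & q (+) q'].

(* Counts mod 2 the passages of a labelled sequence between the labels
   [(true, true)] and [(true, false)]. *)
Definition crossing (p q : nat -> bool) (N : nat) : bool :=
  iteri N (fun j b => b (+) edge (p j) (q j) (p j.+1) (q j.+1)) false.

(* A square whose corners share the first or the second label has an even
   number of edges on its boundary. *)
Lemma crossing_strip p q p' q' N :
  (forall j, (j < N)%N -> [/\ p j.+1 = p j, p' j = p j & p' j.+1 = p j] \/
    [/\ q j.+1 = q j, q' j = q j & q' j.+1 = q j]) ->
  q 0%N = q' 0%N -> q N = q' N -> crossing p q N = crossing p' q' N.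
Proof.
move=> sq q0 qN.
(* The partial counts differ by the edge on the rung joining the two sequences at n; equal [q]
   labels kill this rung at both ends of the strip. *)
suff H n : (n <= N)%N -> crossing p q n =
    crossing p' q' n (+) edge (p n) (q n) (p' n) (q' n).
  by rewrite H// /edge qN addbb !andbF addbF.
elim: n => [_|n ih nN]; first by rewrite /= /edge q0 addbb !andbF.
rewrite /= -/(crossing p q n) -/(crossing p' q' n) ih ?(ltnW nN)// /edge.
case: (sq n nN) => -[-> -> ->];
  by case: (crossing p' q' n); case: (p n); case: (q n); case: (p' n); case: (q' n);
  case: (p n.+1); case: (q n.+1); case: (p' n.+1); case: (q' n.+1).
Qed.

(** A step between equal labels is not an edge. This allows a count on a coarse grid to be compared
    with one on a finer grid. *)
Lemma crossing_repeat p q K N : (0 < K)%N ->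
  crossing (fun j => p (j %/ K)%N) (fun j => q (j %/ K)%N) (N * K) = crossing p q N.
Proof.
move=> K0; suff H n : crossing (fun j => p (j %/ K)%N) (fun j => q (j %/ K)%N) n =
    crossing p q (n %/ K) by rewrite H mulnK.
elim: n => [|n ih]; first by rewrite div0n.
rewrite /= -/(crossing (fun j => p (j %/ K)%N) _ n) ih divnS//.
case: (K %| n.+1)%N => //=; rewrite add0n /edge addbb !andbF addbF //.
Qed.

Lemma crossing_all (p q : nat -> bool) N : (forall j, (j <= N)%N -> p j) ->
  crossing p q N = q 0%N (+) q N.
Proof.
elim: N => [_|N ih pN] /=; first by rewrite addbb.
rewrite -/(crossing p q N) ih => [|j jN]; last by apply: pN; lia.
by rewrite /edge !pN//; case: (q 0%N); case: (q N); case: (q N.+1).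
Qed.

Lemma crossing_none (p q : nat -> bool) N : (forall j, (j <= N)%N -> ~~ p j) -> crossing p q N = false.
Proof.
elim: N => [//|N ih pN] /=; rewrite -/(crossing p q N) ih => [|j jN].
  by rewrite /edge (negbTE (pN N _)).
by apply: pN; lia.
Qed.

Lemma rec_crossing (N : nat -> nat) (p q : nat -> nat -> bool) :
  rec_fun N -> rec_bool (fun z => p (nfst z) (nsnd z)) ->
  rec_bool (fun z => q (nfst z) (nsnd z)) ->
  rec_bool (fun x => crossing (p x) (q x) (N x)).
Proof.
rewrite /rec_bool => hN hp hq.
have hp2 F G : rec_fun F -> rec_fun G -> rec_bool (fun x => p (F x) (G x)).
  by move=> hF hG; apply: (rec_app2 (fun a b => nat_of_bool (p a b))).
have hq2 F G : rec_fun F -> rec_fun G -> rec_bool (fun x => q (F x) (G x)).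
  by move=> hF hG; apply: (rec_app2 (fun a b => nat_of_bool (q a b))).
apply: (rec_iterb _ _ (fun x j b =>
  b (+) edge (p x j) (q x j) (p x j.+1) (q x j.+1))) => //.
rewrite /edge; apply: rec_xor; first by rec_tac.
by apply: rec_and; [|apply: rec_and; [|apply: rec_xor]];
  [apply: hp2|apply: hp2|apply: hq2|apply: hq2]; rec_tac.
Qed.

(* Coordinates of z - w along the diagonals.  The ray u <= 0, v = 0 avoids both
   z - (0, 1) and z - (1, 0) for z in the square, see [side_ends]. *)
Definition ucoord (R : realType) (z w : R * R) : R := z.1 + z.2 - w.1 - w.2.
Definition vcoord (R : realType) (z w : R * R) : R := z.1 - z.2 - w.1 + w.2.

(** A coordinate larger than 2d in absolute value keeps its sign under a change by d, so each square
    has a label common to its corners. At the ends the cone conditions on the primed vectors fix the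
    sign of v for both sequences. Only the unprimed vectors must be far from 0, so either exact
    values or approximations can take that role. *)
Lemma crossing_near (R : realType) (U V U' V' : nat -> R) N (d : R) :
  let near_ a b := `|b - a| <= d in
  0 < d ->
  (forall j, (j <= N)%N -> 2 * d < `|U j| \/ 2 * d < `|V j|) ->
  (forall j, (j <= N)%N -> near_ (U j) (U' j) /\ near_ (V j) (V' j)) ->
  (forall j, (j < N)%N -> [/\ near_ (U j) (U j.+1), near_ (V j) (V j.+1),
    near_ (U j) (U' j.+1) & near_ (V j) (V' j.+1)]) ->
  `|U' 0%N| <= V' 0%N -> `|U' N| <= - V' N ->
  crossing (fun j => U j <= 0) (fun j => 0 < V j) N =
  crossing (fun j => U' j <= 0) (fun j => 0 < V' j) N.
Proof.
move=> near_ d0 far near0 near1 e0 eN.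
have neg a b : near_ a b -> 2 * d < `|a| -> (b <= 0) = (a <= 0).
  rewrite /near_ ler_norml => /andP[h1 h2]; case: (ger0P a) => a0 da.
    have -> : (a <= 0) = false by apply/negbTE; rewrite -ltNge; lra.
    by apply/negbTE; rewrite -ltNge; lra.
  by rewrite (ltW a0); lra.
have pos a b : near_ a b -> 2 * d < `|a| -> (0 < b) = (0 < a).
  by move=> h1 h2; rewrite !ltNge (neg a b).
apply: crossing_strip.
- move=> j jN; have [nU nV nU' nV'] := near1 j jN.
  have [mU mV] := near0 j (ltnW jN).
  by case: (far j (ltnW jN)) => fj; [left|right]; split; (apply: neg || apply: pos).
- have [mU mV] := near0 0%N (leq0n _); have := far 0%N (leq0n _).
  move: mU mV e0; rewrite /near_ !ler_norml => /andP[? ?] /andP[? ?] /andP[? ?] f0.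
  suff [-> ->] : 0 < V 0%N /\ 0 < V' 0%N by [].
  case: f0; [case: (ger0P (U 0%N))|case: (ger0P (V 0%N))] => ? ?; split; lra.
- have [mU mV] := near0 N (leqnn _); have := far N (leqnn _).
  move: mU mV eN; rewrite /near_ !ler_norml => /andP[? ?] /andP[? ?] /andP[? ?] f0.
  suff [hV hV'] : V N <= 0 /\ V' N <= 0 by rewrite !ltNge hV hV'.
  case: f0; [case: (ger0P (U N))|case: (ger0P (V N))] => ? ?; split; lra.
Qed.

(** * Parity of a point with respect to a path *)

Lemma closed_squareP (R : realType) (z : R * R) :
  closed_square z <-> 0 <= z.1 <= 1 /\ 0 <= z.2 <= 1.
Proof. by rewrite /closed_square /= !in_itv. Qed.

Definition side_at (R : realType) (g : R -> R * R) (z : R * R) (k : nat) : bool :=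
  crossing (fun j => ucoord R z (g (j%:R / 2 ^+ k)) <= 0)
    (fun j => 0 < vcoord R z (g (j%:R / 2 ^+ k))) (2 ^ k).

(** An eventual value, because the mesh that suffices depends on the distance from z to the path. *)
Definition side_of (R : realType) (g : R -> R * R) (z : R * R) (b : bool) : Prop :=
  exists k0, forall k, (k0 <= k)%N -> side_at R g z k = b.

Lemma dyadic01 (R : realType) k j : (j <= 2 ^ k)%N -> 0 <= (j%:R / 2 ^+ k : R) <= 1.
Proof.
move=> jk; rewrite divr_ge0 ?exprn_ge0//= ler_pdivrMr ?pow2_gt0// mul1r -natrX.
by rewrite ler_nat.
Qed.

Lemma side_ends (R : realType) (z : R * R) : closed_square z ->
  `|ucoord R z (0, 1)| <= vcoord R z (0, 1) /\
  `|ucoord R z (1, 0)| <= - vcoord R z (1, 0).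
Proof.
move=> /closed_squareP[/andP[? ?] /andP[? ?]].
by rewrite /ucoord /vcoord /= !ler_norml; split; apply/andP; split; lra.
Qed.

Lemma path_ucont (R : realType) (g : R -> R * R) (e : R) :
  (forall t : R, 0 <= t <= 1 -> closed_square (g t)) -> computable_path g -> 0 < e ->
  exists m, forall x y : R, 0 <= x <= 1 -> 0 <= y <= 1 -> `|x - y| * 2 ^+ m <= 1 ->
    `|(g x).1 - (g y).1| <= e /\ `|(g x).2 - (g y).2| <= e.
Proof.
move=> gS [g1C g2C] e0.
have [|m1 h1] := computable_ucont R (fun t => (g t).1) e _ g1C e0.
  by move=> t /gS/closed_squareP[/andP[]].
have [|m2 h2] := computable_ucont R (fun t => (g t).2) e _ g2C e0.
  by move=> t /gS/closed_squareP[_ /andP[]].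
exists (m1 + m2)%N => x y x01 y01 xy.
have ge1 n : 1 <= 2 ^+ n :> R by rewrite -natrX ler1n expn_gt0.
have le1 n : (n <= m1 + m2)%N -> `|x - y| * 2 ^+ n <= 1.
  move=> nm; apply: le_trans xy; rewrite ler_wpM2l// -!natrX ler_nat.
  by rewrite leq_pexp2l.
by split; [apply: h1|apply: h2] => //; apply: le1; rewrite ?leq_addr ?leq_addl.
Qed.

Lemma far_from_range (R : realType) (g : R -> R * R) (z : R * R) :
  (forall t : R, 0 <= t <= 1 -> closed_square (g t)) -> computable_path g ->
  ~ path_range g z ->
  exists2 e : R, 0 < e & forall t, 0 <= t <= 1 ->
    e <= `|ucoord R z (g t)| \/ e <= `|vcoord R z (g t)|.
Proof.
move=> gS gC zg.
pose h (t : R) : R := `|z.1 - (g t).1| + `|z.2 - (g t).2|.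
have hc : {within `[0, 1], continuous h}.
  apply: ucont_within => e e0; have e2 : 0 < e / 2 by rewrite divr_gt0.
  have [m hm] := path_ucont R g (e / 2) gS gC e2; exists m => x y x01 y01 xy.
  have [h1 h2] := hm x y x01 y01 xy.
  rewrite /h opprD addrACA; apply: le_trans (ler_normD _ _) _.
  rewrite [leRHS]splitr; apply: lerD.
    apply: le_trans (ler_dist_dist _ _) _.
    by rewrite (_ : _ - _ = - ((g x).1 - (g y).1)) ?normrN //; ring.
  apply: le_trans (ler_dist_dist _ _) _.
  by rewrite (_ : _ - _ = - ((g x).2 - (g y).2)) ?normrN //; ring.
have [c c01 hmin] := @EVT_min R h 0 1 ler01 hc.
have hc0 : 0 < h c.
  rewrite lt_neqAle addr_ge0// andbT eq_sym paddr_eq0// !normr_eq0 !subr_eq0.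
  apply/negP => /andP[/eqP e1 /eqP e2]; apply: zg; exists c => //.
  by rewrite [z]surjective_pairing e1 e2; case: (g c).
exists (h c) => // t t01; have := hmin t; rewrite in_itv /= => /(_ t01).
rewrite [h t]/h /ucoord /vcoord; set a := z.1 - (g t).1; set b := z.2 - (g t).2 => hab.
have -> : z.1 + z.2 - (g t).1 - (g t).2 = a + b by rewrite /a /b; ring.
have -> : z.1 - z.2 - (g t).1 + (g t).2 = a - b by rewrite /a /b; ring.
(* The minimum was taken for the l1 distance because |a| + |b| is the larger of |a + b| and |a - b|,
   that is, of |u| and |v|. *)
case: (ger0P a) hab => ?; case: (ger0P b) => ? hab.
- by left; apply: le_trans hab (ler_norm _).
- by right; apply: le_trans hab (ler_norm _).
- by right; rewrite -normrN; apply: le_trans (ler_norm _); move: hab; lra.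
- by left; rewrite -normrN; apply: le_trans (ler_norm _); move: hab; lra.
Qed.

Lemma side_near (R : realType) (g : R -> R * R) (z z' : R * R) (e : R) :
  (forall t : R, 0 <= t <= 1 -> closed_square (g t)) -> computable_path g ->
  g 0 = (0, 1) -> g 1 = (1, 0) -> closed_square z' -> 0 < e ->
  (forall t, 0 <= t <= 1 -> e <= `|ucoord R z (g t)| \/ e <= `|vcoord R z (g t)|) ->
  `|z'.1 - z.1| <= e / 16 -> `|z'.2 - z.2| <= e / 16 ->
  exists k0, forall k, (k0 <= k)%N -> side_at R g z k = side_at R g z' k.
Proof.
move=> gS gC g0 g1 z'S e0 far h1 h2.
have e16 : 0 < e / 16 by rewrite divr_gt0.
have [m hm] := path_ucont R g (e / 16) gS gC e16.
exists m => k mk; rewrite /side_at.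
have P0 := pow2_gt0 R k.
have step j : (j < 2 ^ k)%N ->
    `|(g (j.+1%:R / 2 ^+ k)).1 - (g (j%:R / 2 ^+ k)).1| <= e / 16 /\
    `|(g (j.+1%:R / 2 ^+ k)).2 - (g (j%:R / 2 ^+ k)).2| <= e / 16.
  move=> jk; apply: hm; [exact: dyadic01|exact/dyadic01/ltnW|].
  rewrite -mulrBl -natr1 addrAC subrr add0r mul1r gtr0_norm ?invr_gt0//.
  by rewrite mulrC ler_pdivrMr// mul1r -!natrX ler_nat leq_pexp2l.
(* Both coordinates of z and both of g move by at most e/16, so u and v move by at most e/4, and
   twice this is below e. *)
apply: (@crossing_near R _ _ _ _ (2 ^ k) (e / 4)) => [|j jk|j jk|j jk||].
- by rewrite divr_gt0.
- by case: (far _ (dyadic01 R k j jk)) => ?; [left|right]; lra.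
- move: h1 h2; rewrite /ucoord /vcoord !ler_norml => /andP[? ?] /andP[? ?].
  by split; apply/andP; split; lra.
- have [] := step j jk; move: h1 h2.
  rewrite /ucoord /vcoord !ler_norml => /andP[? ?] /andP[? ?] /andP[? ?] /andP[? ?].
  by split; apply/andP; split; lra.
- by rewrite mul0r g0; have [] := side_ends R z' z'S.
- by rewrite natrX divff ?gt_eqF// g1; have [] := side_ends R z' z'S.
Qed.

(** * Computing the parity at dyadic points *)

Lemma path_approx (R : realType) (f : R -> R * R) :
  (forall t : R, 0 <= t <= 1 -> closed_square (f t)) -> computable_path f ->
  exists M D1 D2, [/\ rec_fun M,
    rec_fun (fun z => D1 (nfst z) (nfst (nsnd z)) (nsnd (nsnd z))),
    rec_fun (fun z => D2 (nfst z) (nfst (nsnd z)) (nsnd (nsnd z))) &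
    forall n m j (x : R), (M n <= m)%N -> (j <= 2 ^ m)%N -> cell R m j x -> 0 <= x <= 1 ->
      `|(f x).1 * 2 ^+ n - (D1 n m j)%:R| <= 2 /\
      `|(f x).2 * 2 ^+ n - (D2 n m j)%:R| <= 2].
Proof.
move=> fS [f1C f2C].
have [|M1 [D1 [rM1 rD1 h1]]] := uniform_approx R (fun t => (f t).1) _ f1C.
  by move=> t /fS/closed_squareP[/andP[]].
have [|M2 [D2 [rM2 rD2 h2]]] := uniform_approx R (fun t => (f t).2) _ f2C.
  by move=> t /fS/closed_squareP[_ /andP[]].
exists (fun n => M1 n + M2 n)%N, D1, D2; split=> //; first by rec_tac.
move=> n m j x Mm jm xc x01.
by split; [apply: h1|apply: h2] => //; lia.
Qed.

Lemma rec_app3 H F G K : rec_fun (fun z => H (nfst z) (nfst (nsnd z)) (nsnd (nsnd z))) ->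
  rec_fun F -> rec_fun G -> rec_fun K -> rec_fun (fun x => H (F x) (G x) (K x)).
Proof.
move=> hH hF hG hK.
apply: (rec_ext (fun x => (fun z => H (nfst z) (nfst (nsnd z)) (nsnd (nsnd z)))
  (npair (F x) (npair (G x) (K x))))) => [x|]; first by rewrite !(nfst_pair, nsnd_pair).
by apply: (rec_comp _ _ hH); rec_tac.
Qed.

(** The tests u <= 0 and, below, v > 0 on integer approximations, with terms moved across to avoid
    truncated subtraction. *)
Definition ulab (a1 a2 b1 b2 : nat) : bool := (a1 + a2 <= b1 + b2)%N.
Definition vlab (a1 a2 b1 b2 : nat) : bool := (a2 + b1 < a1 + b2)%N.
(* In units of 2^-n the approximations of u and v are off by at most 8, hence
   vary by at most 16 along a step of the grid, and [crossing_near] needs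
   twice as much. *)
Definition far_lab (a1 a2 b1 b2 : nat) : bool :=
  [|| (b1 + b2 + 32 < a1 + a2)%N, (a1 + a2 + 32 < b1 + b2)%N,
    (a2 + b1 + 32 < a1 + b2)%N | (a1 + b2 + 32 < a2 + b1)%N].

Lemma ulabE (R : realType) a1 a2 b1 b2 :
  ulab a1 a2 b1 b2 = (a1%:R + a2%:R - b1%:R - b2%:R <= 0 :> R).
Proof. by rewrite /ulab -addrA -opprD subr_le0 -!natrD ler_nat. Qed.

Lemma vlabE (R : realType) a1 a2 b1 b2 :
  vlab a1 a2 b1 b2 = (0 < a1%:R - a2%:R - b1%:R + b2%:R :> R).
Proof.
by rewrite /vlab -(ltr_nat R) !natrD -subr_gt0; congr (0 < _); ring.
Qed.


Lemma far_labE (R : realType) a1 a2 b1 b2 : far_lab a1 a2 b1 b2 <->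
  2 * 16 < `|a1%:R + a2%:R - b1%:R - b2%:R : R| \/
  2 * 16 < `|a1%:R - a2%:R - b1%:R + b2%:R : R|.
Proof.
rewrite /far_lab -!(ltr_nat R) !natrD !ltr_normr.
split=> [/or4P[] ?|[] /orP[] ?].
- by left; apply/orP; left; lra.
- by left; apply/orP; right; lra.
- by right; apply/orP; left; lra.
- by right; apply/orP; right; lra.
- by apply/or4P/Or41; lra.
- by apply/or4P/Or42; lra.
- by apply/or4P/Or43; lra.
- by apply/or4P/Or44; lra.
Qed.

(** A precision n is searched at which the approximations themselves certify, by [far_lab], that
    they stay away from 0. The search ends because the point has positive distance from range(g),
    and the count at that precision then equals the exact count on all finer grids. *)
Lemma side_computable (R : realType) (f g : R -> R * R) :
  (forall t : R, 0 <= t <= 1 -> closed_square (f t)) -> computable_path f ->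
  (forall t : R, 0 <= t <= 1 -> closed_square (g t)) -> computable_path g ->
  g 0 = (0, 1) -> g 1 = (1, 0) ->
  (forall l i, (i <= 2 ^ l)%N -> ~ path_range g (f (i%:R / 2 ^+ l))) ->
  exists2 w, rec_bool w &
    forall l i, (i <= 2 ^ l)%N -> side_of R g (f (i%:R / 2 ^+ l)) (w (npair l i)).
Proof.
move=> fS fC gS gC g0 g1 avoid.
have [M [A1 [A2 [rM rA1 rA2 hA]]]] := path_approx R f fS fC.
have [M' [B1 [B2 [rM' rB1 rB2 hB]]]] := path_approx R g gS gC.
(* Fine enough for both paths, and a refinement of level [nfst z], so that the point coded by z is
   the grid point number [idx z n]. *)
pose lev z n := (M n + M' n + nfst z)%N.
pose idx z n := (minn (nsnd z) (2 ^ nfst z) * 2 ^ (M n + M' n))%N.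
pose lift_ (F : nat -> nat -> nat -> nat -> bool) z n j :=
  F (A1 n (lev z n) (idx z n)) (A2 n (lev z n) (idx z n))
    (B1 n (lev z n) j) (B2 n (lev z n) j).
have rlift F N Z J : (forall a1 a2 b1 b2, rec_fun a1 -> rec_fun a2 -> rec_fun b1 ->
    rec_fun b2 -> rec_bool (fun x => F (a1 x) (a2 x) (b1 x) (b2 x))) ->
    rec_fun Z -> rec_fun N -> rec_fun J -> rec_bool (fun x => lift_ F (Z x) (N x) (J x)).
  move=> rF rZ rN rJ; apply: rF; apply: rec_app3 => //; rewrite /lev /idx; rec_tac.
pose ok z n := iteri (2 ^ lev z n).+1 (fun j b => b && lift_ far_lab z n j) true.
have rok : rec_bool (fun x => ok (nfst x) (nsnd x)).
  apply: (rec_iterb _ _ (fun x j b => b && lift_ far_lab (nfst x) (nsnd x) j)).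
    by rewrite /lev; rec_tac.
  apply: rec_and; first by rec_tac.
  apply: rlift; [|by rec_tac|by rec_tac|by rec_tac].
  by move=> *; rewrite /far_lab; rec_tac.
pose U (z n j : nat) : R := (A1 n (lev z n) (idx z n))%:R + (A2 n (lev z n) (idx z n))%:R
  - (B1 n (lev z n) j)%:R - (B2 n (lev z n) j)%:R.
pose V (z n j : nat) : R := (A1 n (lev z n) (idx z n))%:R - (A2 n (lev z n) (idx z n))%:R
  - (B1 n (lev z n) j)%:R + (B2 n (lev z n) j)%:R.
pose pt z : R := (minn (nsnd z) (2 ^ nfst z))%:R / 2 ^+ nfst z.
have jm z : (minn (nsnd z) (2 ^ nfst z) <= 2 ^ nfst z)%N by apply: geq_minr.
have pt01 z : 0 <= pt z <= 1 by apply: dyadic01.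
(* Four coordinates, each off by at most 2, give the error 8. *)
have UV z n j t : (j <= 2 ^ lev z n)%N -> cell R (lev z n) j t -> 0 <= t <= 1 ->
    `|ucoord R (f (pt z)) (g t) * 2 ^+ n - U z n j| <= 8 /\
    `|vcoord R (f (pt z)) (g t) * 2 ^+ n - V z n j| <= 8.
  move=> jl jt t01.
  have ip : cell R (lev z n) (idx z n) (pt z).
    have e : 2 ^+ lev z n = 2 ^+ nfst z * 2 ^+ (M n + M' n)%N :> R.
      by rewrite -exprD /lev addnC.
    rewrite /cell e /pt /idx mulrA divfK ?gt_eqF ?pow2_gt0//.
    by rewrite -natrX -natrM !ler_nat leqnn leqnSn.
  have il : (idx z n <= 2 ^ lev z n)%N.
    have e : (2 ^ lev z n = 2 ^ nfst z * 2 ^ (M n + M' n))%N by rewrite -expnD /lev addnC.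
    by rewrite e /idx leq_mul2r jm orbT.
  have [|] := hA n _ _ _ _ il ip (pt01 z); first by rewrite /lev; lia.
  have [|] := hB n _ _ _ _ jl jt t01; first by rewrite /lev; lia.
  rewrite /ucoord /vcoord /U /V !ler_norml.
  move=> /andP[? ?] /andP[? ?] /andP[? ?] /andP[? ?].
  by split; apply/andP; split; lra.
have exok z : exists n, ok z n.
  have [e e0 far] := far_from_range R g (f (pt z)) gS gC (avoid _ _ (jm z)).
  (* One exact coordinate is then at least 64, and its approximation at least 64 - 8 > 32. *)
  have [n hn] := exists_pow2_ge R (64 / e).
  have P0 := pow2_gt0 R n.
  have {}hn : 64 <= e * 2 ^+ n by rewrite mulrC -ler_pdivrMr.
  exists n; apply/iteri_all => j; rewrite ltnS => jl; apply/(far_labE R).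
  have [] := UV z n j (j%:R / 2 ^+ lev z n) jl _ (dyadic01 R _ _ jl).
    by rewrite /cell divfK ?gt_eqF ?pow2_gt0// lexx ler_nat leqnSn.
  rewrite -/(U z n j) -/(V z n j) => hU hV.
  have big (a b : R) : e <= `|a| -> `|a * 2 ^+ n - b| <= 8 -> 2 * 16 < `|b|.
    move=> ea ab; have : 64 <= `|a * 2 ^+ n|.
      by apply: le_trans hn _; rewrite normrM (gtr0_norm P0) ler_pM2r.
    by have := lerB_dist (a * 2 ^+ n) b; move: ab; lra.
  by case: (far _ (dyadic01 R _ _ jl)) => h; [left|right]; apply: big h _.
have [N rN hN] := rec_search ok rok exok.
exists (fun z => crossing (lift_ ulab z (N z)) (lift_ vlab z (N z)) (2 ^ lev z (N z))).
  apply: (rec_crossing _ (fun z => lift_ ulab z (N z)) (fun z => lift_ vlab z (N z))).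
  - by rewrite /lev; rec_tac.
  - apply: rlift; [|by rec_tac|by rec_tac|by rec_tac].
    by move=> *; rewrite /ulab; rec_tac.
  - apply: rlift; [|by rec_tac|by rec_tac|by rec_tac].
    by move=> *; rewrite /vlab; rec_tac.
move=> l i il; pose z := npair l i; pose n := N z; rewrite -/z -/n.
have ez : pt z = i%:R / 2 ^+ l by rewrite /pt /z nfst_pair nsnd_pair (minn_idPl il).
rewrite -ez; pose m := lev z n.
have far j : (j <= 2 ^ m)%N -> 2 * 16 < `|U z n j| \/ 2 * 16 < `|V z n j|.
  by move=> jl; apply/far_labE; have /iteri_all := hN z; apply; rewrite ltnS.
exists m => k mk; pose K := (2 ^ (k - m))%N.
have K0 : (0 < K)%N by rewrite expn_gt0.
have eK : (2 ^ k = 2 ^ m * K)%N by rewrite -expnD subnKC.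
have P0 := pow2_gt0 R n; have Q0 := pow2_gt0 R k.
rewrite -(crossing_repeat _ _ K) // -eK.
pose u j := ucoord R (f (pt z)) (g (j%:R / 2 ^+ k)) * 2 ^+ n.
pose v j := vcoord R (f (pt z)) (g (j%:R / 2 ^+ k)) * 2 ^+ n.
transitivity (crossing (fun j => u j <= 0) (fun j => 0 < v j) (2 ^ k)).
  rewrite /side_at; congr (crossing _ _ _); apply/funext => j.
    by rewrite /u pmulr_lle0.
  by rewrite /v pmulr_lgt0.
transitivity (crossing (fun j => U z n (j %/ K)%N <= 0) (fun j => 0 < V z n (j %/ K)%N)
    (2 ^ k)); last first.
  congr (crossing _ _ _); apply/funext => j.
    by rewrite /lift_ (ulabE R).
  by rewrite /lift_ (vlabE R).
have dK j : (j <= 2 ^ k)%N -> (j %/ K <= 2 ^ m)%N by apply: div_le_pow2.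
have cK j : cell R m (j %/ K) (j%:R / 2 ^+ k).
  apply: cell_coarsen => //.
  by rewrite /cell divfK ?gt_eqF// lexx ler_nat leqnSn.
(* The next fine grid point is still in the same closed coarse cell, so the approximation for j also
   serves there. *)
have cK1 j : cell R m (j %/ K) (j.+1%:R / 2 ^+ k).
  have KR : 0 < K%:R :> R by rewrite ltr0n.
  have e : 2 ^+ k = 2 ^+ m * K%:R :> R by rewrite -!natrX eK natrM.
  have e2 : j.+1%:R / 2 ^+ k * 2 ^+ m = j.+1%:R / K%:R :> R.
    by rewrite e invfM mulrA mulrAC divfK ?gt_eqF ?pow2_gt0.
  rewrite /cell e2 ler_pdivlMr// ler_pdivrMr// -!natrM !ler_nat ltn_ceil// andbT.
  by apply: leq_trans (leqnSn j); apply: leq_trunc_div.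
have near0 j : (j <= 2 ^ k)%N ->
    `|u j - U z n (j %/ K)%N| <= 8 /\ `|v j - V z n (j %/ K)%N| <= 8.
  by move=> jk; apply: UV; [exact: dK|exact: cK|exact: dyadic01].
have near1 j : (j < 2 ^ k)%N ->
    `|u j.+1 - U z n (j %/ K)%N| <= 8 /\ `|v j.+1 - V z n (j %/ K)%N| <= 8.
  by move=> jk; apply: UV; [exact/dK/ltnW|exact: cK1|exact: dyadic01].
have fzS := fS _ (pt01 z).
apply/esym/(@crossing_near R _ _ _ _ (2 ^ k) 16) => [|j jk|j jk|j jk||] //.
- by apply: far; apply: dK.
- by have [h1 h2] := near0 j jk; split; [move: h1|move: h2]; lra.
(* Consecutive approximations are both within 8 of the exact value at [j.+1], hence within 16 of
   each other. *)
- have [h1 h2] := near1 j jk; have [h3 h4] := near0 j.+1 jk.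
  move: h1 h2 h3 h4; rewrite !ler_norml.
  move=> /andP[? ?] /andP[? ?] /andP[? ?] /andP[? ?].
  by split; apply/andP; split; lra.
- rewrite /u /v mul0r g0 normrM (gtr0_norm P0) ler_pM2r//.
  by have [] := side_ends R _ fzS.
- rewrite /u /v natrX divff ?gt_eqF// g1 normrM (gtr0_norm P0) -mulNr ler_pM2r//.
  by have [] := side_ends R _ fzS.
Qed.

(** * The intersection point *)

Lemma open_squareP (R : realType) (z : R * R) :
  open_square z <-> 0 < z.1 < 1 /\ 0 < z.2 < 1.
Proof. by rewrite /open_square /= !in_itv. Qed.

Lemma computable_path_point (R : realType) (f : R -> R * R) (x : R) :
  computable_path f -> 0 <= x <= 1 -> computable_real x -> computable_point (f x).
Proof.
move=> [f1C f2C] x01 xC; split.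
  exact: (computable_image R (fun t => (f t).1)).
exact: (computable_image R (fun t => (f t).2)).
Qed.

(** Seen from (0,0) the whole path has u <= 0, so the count telescopes to the change of sign of v
    between its ends. *)
Lemma side_bottom_left (R : realType) (g : R -> R * R) :
  (forall t : R, 0 <= t <= 1 -> closed_square (g t)) -> g 0 = (0, 1) -> g 1 = (1, 0) ->
  side_of R g (0, 0) true.
Proof.
move=> gS g0 g1; exists 0%N => k _; rewrite /side_at crossing_all => [|j jk].
  rewrite mul0r g0 natrX divff ?gt_eqF ?pow2_gt0// g1 /vcoord /=.
  have -> : (0 < 0 - 0 - 0 + 1 :> R) = true by lra.
  by have -> : (0 < 0 - 0 - 1 + 0 :> R) = false by lra.
have /closed_squareP[/andP[? ?] /andP[? ?]] := gS _ (dyadic01 R k j jk).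
by rewrite /ucoord /=; lra.
Qed.

(** Here u > 0 along the whole path; u could vanish only at the corner (1,1), which [gI]
    excludes. *)
Lemma side_top_right (R : realType) (g : R -> R * R) :
  (forall t : R, 0 < t < 1 -> open_square (g t)) -> g 0 = (0, 1) -> g 1 = (1, 0) ->
  side_of R g (1, 1) false.
Proof.
move=> gI g0 g1; exists 0%N => k _; apply: crossing_none => j jk.
rewrite -ltNge; move: (j%:R / 2 ^+ k) (dyadic01 R k j jk) => t /andP[].
rewrite le_eqVlt => /predU1P[<- _|t0]; first by rewrite g0 /ucoord /=; lra.
rewrite le_eqVlt => /predU1P[->|t1]; first by rewrite g1 /ucoord /=; lra.
have /gI/open_squareP[/andP[? ?] /andP[? ?]] : 0 < t < 1 by rewrite t0.
by rewrite /ucoord /=; lra.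
Qed.

Theorem theorem5p6 (R : realType) (f g : R -> R * R)
  (fS : forall t : R, 0 <= t <= 1 -> closed_square (f t))
  (gS : forall t : R, 0 <= t <= 1 -> closed_square (g t))
  (fC : computable_path f) (gC : computable_path g)
  (f0 : f 0 = (0, 0)) (f1 : f 1 = (1, 1))
  (g0 : g 0 = (0, 1)) (g1 : g 1 = (1, 0))
  (fI : forall t : R, 0 < t < 1 -> open_square (f t))
  (gI : forall t : R, 0 < t < 1 -> open_square (g t)) :
  ~ predQ f g ->
  exists2 x : R * R, computable_point x & (path_range f `&` path_range g) x.
Proof.
move=> _.
suff [x [x01 xC xg]] : exists x : R,
    [/\ 0 <= x <= 1, computable_real x & path_range g (f x)].
  exists (f x); first exact: computable_path_point.
  by split => //; exists x; rewrite //= in_itv.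
have [[l [i [il lg]]]|avoid] := pselect (exists l i,
    (i <= 2 ^ l)%N /\ path_range g (f (i%:R / 2 ^+ l))).
  exists (i%:R / 2 ^+ l); split=> //; first exact: dyadic01.
  exists (fun=> dyadic_code l i); first exact/rec_fun_recursive/rec_const.
  by move=> n; rewrite ratr_dyadic_code subrr normr0 invr_ge0 exprn_ge0.
have {}avoid l i : (i <= 2 ^ l)%N -> ~ path_range g (f (i%:R / 2 ^+ l)).
  by move=> il lg; apply: avoid; exists l, i.
have [w rw hw] := side_computable R f g fS fC gS gC g0 g1 avoid.
(* The current interval has ends i / 2^k and (i + 1) / 2^k, and its midpoint has index 2i + 1 at the
   next level. An odd parity there makes it the new left end. *)
pose J k := iteri k (fun k i =>
  if w (npair k.+1 (i * 2).+1) then (i * 2).+1 else (i * 2)%N) 0%N.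
have JS k : J k.+1 = if w (npair k.+1 (J k * 2).+1) then (J k * 2).+1 else (J k * 2)%N by [].
have recJ : rec_fun J.
  apply: (rec_iteri _ _ (fun _ k i =>
    if w (npair k.+1 (i * 2).+1) then (i * 2).+1 else (i * 2)%N)).
  - exact: rec_id.
  - exact: rec_const.
  - by apply: rec_if; [apply: (rec_comp _ _ rw); rec_tac|rec_tac|rec_tac].
have Jpath : dyadic_path J.
  by move=> k; rewrite JS muln2; case: ifP => _; [right|left].
have halve k i : (i * 2)%:R / 2 ^+ k.+1 = i%:R / 2 ^+ k :> R.
  by rewrite natrM exprSr -mulf_div divff ?mulr1.
have inv k : [/\ (J k < 2 ^ k)%N, side_of R g (f ((J k)%:R / 2 ^+ k)) true &
    side_of R g (f ((J k).+1%:R / 2 ^+ k)) false].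
  elim: k => [|k [Jk sl sr]].
    rewrite /= expr0 !divr1 f0 f1; split=> //.
      exact: side_bottom_left.
    exact: side_top_right.
  have mid : ((J k * 2).+1 <= 2 ^ k.+1)%N by rewrite expnSr; lia.
  have := hw _ _ mid; rewrite JS; case: (w _) => sm.
    split=> //; first by rewrite expnSr; lia.
    have -> : ((J k * 2).+2 = (J k).+1 * 2)%N by lia.
    by rewrite halve.
  by split=> //; rewrite halve.
have [x xJ xlub] := dyadic_path_point R J Jpath.
have x01 : 0 <= x <= 1.
  have := xJ 0%N; rewrite /cell expr0 mulr1 => /andP[-> _] /=.
  apply: xlub => k; rewrite mul1r -natrX ler_nat ltnW//.
  by have [] := inv k.
exists x; split=> //.
  exists (fun k => dyadic_code k (J k)).
    by apply/rec_fun_recursive/rec_dyadic_code => //; apply: rec_id.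
  by move=> k; apply: cell_name.
apply: contrapT => xg.
have [e e0 far] := far_from_range R g (f x) gS gC xg.
have e16 : 0 < e / 16 by rewrite divr_gt0.
have [m hm] := path_ucont R f (e / 16) fS fC e16.
have P0 := pow2_gt0 R m.
(* Applied to the two ends of the interval of level m, this makes both their parities agree with the
   count at f(x) on all fine grids, against [inv m]. *)
have same (y : R) : 0 <= y <= 1 -> `|y - x| * 2 ^+ m <= 1 ->
    exists k0, forall k, (k0 <= k)%N -> side_at R g (f x) k = side_at R g (f y) k.
  move=> y01 yx; have [h1 h2] := hm y x y01 x01 yx.
  exact: (side_near R g (f x) (f y) e gS gC g0 g1 (fS _ y01) e0 far).
have [Jm [k1 sl] [k2 sr]] := inv m.
have := xJ m => /andP[c1 c2].
have near_ i : `|i%:R - x * 2 ^+ m| <= 1 -> `|i%:R / 2 ^+ m - x| * 2 ^+ m <= 1.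
  move=> h; have := normrM (i%:R / 2 ^+ m - x) (2 ^+ m).
  by rewrite mulrBl divfK ?gt_eqF// (gtr0_norm P0) => <-.
have [|k3 s3] := same _ (dyadic01 R m _ (ltnW Jm)).
  by apply: near_; move: c2; rewrite ler_norml -natr1; lra.
have [|k4 s4] := same _ (dyadic01 R m _ Jm).
  by apply: near_; move: c2; rewrite ler_norml -natr1; lra.
pose k := (k1 + k2 + k3 + k4)%N.
by have := s3 k; rewrite s4 ?sl ?sr /k; lia.
Qed.
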